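(* Let $N\geqslant 2$ and $B_1(0)=\{x\in\mathbb{R}^N:|x|<1\}$. Let $f:[0,1)\times\mathbb{R}\times[0,\infty)\to\mathbb{R}$, $(r,u,t)\mapsto f(r,u,t)$, satisfy conditions (F1), (F2) and (F3) listed in the context. Let $u\in C^{2,1}(B_1(0)\times(0,\infty))\cap C(\overline{B_1(0)}\times[0,\infty))$ be a bounded solution, positive in $B_1(0)\times(0,\infty)$, of $$\frac{\partial u}{\partial t}(x,t)-\Delta u(x,t)=f(|x|,u(x,t),t)\ \text{ for }(x,t)\in B_1(0)\times(0,\infty),\qquad u(x,t)=0\ \text{ for }(x,t)\in\partial B_1(0)\times(0,\infty),$$ such that $\partial u/\partial t$ is non-negative and bounded in $B_1(0)\times(0,\infty)$ and $\nabla u(x,t)$ is bounded for $(x,t)\in B_1(0)\times(0,\infty)$. Then for each $\varphi\in\omega(u)$ one of the following holds: (i) $\varphi(x)\equiv 0$; or (ii) $\varphi$ is radially symmetric about the origin and, writing $\varphi(x)=\varphi(r)$ with $r=|x|$, it satisfies $\partial_r\left((1+r^2)^{\frac{N-2}{2}}\varphi(r)\right)<0$ for all $r\in(0,1)$.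
   Context: $C^{2,1}$ means twice continuously differentiable in $x$ and once continuously differentiable in $t$; $\Delta$ and $\nabla$ are taken in $x$. $C_0(\overline{B_1(0)})$ is the space of continuous functions on $\overline{B_1(0)}$ vanishing on $\partial B_1(0)$, with the sup norm. The $\omega$-limit set of $u$ is $$\omega(u)=\{\varphi\in C_0(\overline{B_1(0)}) : \exists\, t_k\to\infty\text{ such that }\varphi=\lim_{k\to\infty}u(\cdot,t_k)\text{ in }C_0(\overline{B_1(0)})\}.$$ Conditions on $f$, with a fixed exponent $\alpha\in(0,1)$: (F1) For each $M>0$, $f(r,u,t)$ is Lipschitz continuous in $u$, uniformly with respect to $r$ and $t$, on $(0,1)\times[-M,M]\times[0,\infty)$. (F2) There exist a constant $H$ and a small constant $\varepsilon_0>0$ such that for every $\tau>0$ (with $H,\varepsilon_0$ independent of $\tau$), $$|f(r_1,u,t_1)-f(r_2,u,t_2)|\leqslant H\left(|r_1-r_2|^{\alpha}+|t_1-t_2|^{\frac{\alpha}{2}}\right)$$ for all $u\in(0,\infty)$ and all $(r_1,t_1),(r_2,t_2)\in(0,1)\times[\tau-\varepsilon_0,\tau+\varepsilon_0]$ with $t_1,t_2\geqslant 0$. (F3) For all $t\in[0,\infty)$ and each fixed $u\in(0,\infty)$, the function $r\mapsto(1+r^2)^{\frac{N+2}{2}}f\left(r,(1+r^2)^{-\frac{N-2}{2}}u,t\right)$ is (strictly) decreasing on $(0,1)$. *)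

(* Defs.v *)
From HB Require Import structures.
From mathcomp Require Import all_boot all_order all_algebra.
From mathcomp Require Import all_classical all_reals all_analysis.

Set Implicit Arguments.
Unset Strict Implicit.
Unset Printing Implicit Defensive.

Import Order.TTheory GRing.Theory Num.Theory.
Import numFieldNormedType.Exports.

Local Open Scope classical_set_scope.
Local Open Scope ring_scope.

(* The library norm `|x| on 'rV[R]_N is the sup norm, so the Euclidean one is
   defined here; both induce the same topology. *)
Definition enorm (R : realType) (N : nat) (x : 'rV[R]_N) : R :=
  Num.sqrt (\sum_(i < N) x 0 i ^+ 2).

Definition unit_ball (R : realType) (N : nat) : set 'rV[R]_N :=
  [set x | enorm x < 1].

Definition unit_cball (R : realType) (N : nat) : set 'rV[R]_N :=
  [set x | enorm x <= 1].

Definition unit_sphere (R : realType) (N : nat) : set 'rV[R]_N :=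
  [set x | enorm x = 1].

Arguments unit_ball R N : clear implicits.
Arguments unit_cball R N : clear implicits.
Arguments unit_sphere R N : clear implicits.

Definition cylinder (R : realType) (N : nat) : set ('rV[R]_N * R) :=
  [set p | unit_ball R N p.1 /\ 0 < p.2].

Definition ccylinder (R : realType) (N : nat) : set ('rV[R]_N * R) :=
  [set p | unit_cball R N p.1 /\ 0 <= p.2].

Arguments cylinder R N : clear implicits.
Arguments ccylinder R N : clear implicits.

Definition partial (R : realType) (N : nat) (i : 'I_N) (g : 'rV[R]_N -> R)
  (x : 'rV[R]_N) : R := 'D_(delta_mx 0 i) g x.

Definition grad (R : realType) (N : nat) (g : 'rV[R]_N -> R) (x : 'rV[R]_N) :
  'rV[R]_N := \row_i partial i g x.

Definition laplacian (R : realType) (N : nat) (g : 'rV[R]_N -> R)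
  (x : 'rV[R]_N) : R := \sum_(i < N) partial i (partial i g) x.

(* A function of (x, t) is represented by a total function, of which only the
   values on B_1(0) x (0, oo), resp. its closure, matter. The derivatives 'D
   and derive1 are total with junk values, so existence is stated separately. *)
Definition C21 (R : realType) (N : nat) (u : 'rV[R]_N -> R -> R) : Prop :=
  [/\ {within cylinder R N, continuous (fun p => u p.1 p.2)},
      forall p, cylinder R N p -> derivable (u p.1) p.2 1,
      {within cylinder R N, continuous (fun p => derive1 (u p.1) p.2)},
      forall i, (forall p, cylinder R N p ->
                   derivable (u^~ p.2) p.1 (delta_mx 0 i)) /\
        {within cylinder R N, continuous (fun p => partial i (u^~ p.2) p.1)} &
      forall i j, (forall p, cylinder R N p ->
                   derivable (partial i (u^~ p.2)) p.1 (delta_mx 0 j)) /\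
        {within cylinder R N,
          continuous (fun p => partial j (partial i (u^~ p.2)) p.1)}].

Definition C0_cball (R : realType) (N : nat) : set ('rV[R]_N -> R) :=
  [set phi | {within unit_cball R N, continuous phi} /\
             forall x, unit_sphere R N x -> phi x = 0].

Arguments C0_cball R N : clear implicits.

Definition omega_limit (R : realType) (N : nat) (u : 'rV[R]_N -> R -> R) :
  set ('rV[R]_N -> R) :=
  [set phi | C0_cball R N phi /\
     exists t : nat -> R, t k @[k --> \oo] --> +oo /\
       {uniform unit_cball R N, (fun k => u^~ (t k)) @ \oo --> phi}].

Definition F1 (R : realType) (f : R -> R -> R -> R) : Prop :=
  forall M : R, 0 < M -> exists L : R, forall r u v t : R,
    0 < r < 1 -> - M <= u <= M -> - M <= v <= M -> 0 <= t ->
    `|f r u t - f r v t| <= L * `|u - v|.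

Definition F2 (R : realType) (alpha : R) (f : R -> R -> R -> R) : Prop :=
  exists H e0 : R, 0 < e0 /\
    forall tau : R, 0 < tau -> forall u r1 r2 t1 t2 : R,
      0 < u -> 0 < r1 < 1 -> 0 < r2 < 1 ->
      tau - e0 <= t1 <= tau + e0 -> tau - e0 <= t2 <= tau + e0 ->
      0 <= t1 -> 0 <= t2 ->
      `|f r1 u t1 - f r2 u t2|
        <= H * (`|r1 - r2| `^ alpha + `|t1 - t2| `^ (alpha / 2)).

Definition F3 (R : realType) (N : nat) (f : R -> R -> R -> R) : Prop :=
  forall t u : R, 0 <= t -> 0 < u ->
  let g (r : R) : R := (1 + r ^+ 2) `^ ((N%:R + 2) / 2)
             * f r ((1 + r ^+ 2) `^ (- ((N%:R - 2) / 2)) * u) t in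
  forall r1 r2 : R, 0 < r1 -> r1 < r2 -> r2 < 1 -> g r2 < g r1.

(* phi is given on the closed ball by the profile g *)
Definition radial_profile (R : realType) (N : nat) (phi : 'rV[R]_N -> R)
  (g : R -> R) : Prop := forall x, unit_cball R N x -> phi x = g (enorm x).

(* Main.v *)
Require Import Defs.
From HB Require Import structures.
From mathcomp Require Import all_boot all_order all_algebra.
From mathcomp Require Import ring lra.
From mathcomp Require Import all_classical all_reals all_analysis.

(** The solution is nondecreasing in time, so u(., t) increases to phi uniformly on
    the closed ball. In particular phi is positive inside, and the second
    alternative has to be proved for it.

    Symmetry is obtained by moving spheres. For a vector c, consider the inversion
    I of centre -c and power 1 + |c|^2, with conformal factor
    mu = (1 + |c|^2) / |x + c|^2. Under stereographic projection it is a reflection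
    of the unit sphere of R^(N+1) in a hyperplane through its centre, so these
    inversions play the role of the moving planes. The Kelvin transform
    u_c = mu^((N-2)/2) (u o I) satisfies
      Delta u_c = mu^((N+2)/2) (Delta u) o I       and
      1 + |I x|^2 = mu (1 + |x|^2)
    ([has_lap_kelvin], [invc_dot]). Hence [F3] compares the right-hand sides of the
    equations of u_c and of u on the cap |x|^2 + 2 c.x > 1 of the ball, where
    |I x| < |x|: the difference w = u_c - u satisfies
    Delta w <= mu^2 w_t + L |w| with the Lipschitz constant L of f, which is
    independent of c ([nonlinearity_comparison], [Wdiff_supersol]).

    At finite times w is smooth but has no sign, while its limit phi_c - phi is
    merely continuous. The inequality is therefore carried to the limit in the sense
    of touching test functions ([supersol], [limit_supersol]); the time derivative
    disappears because u(., t) converges. Explicit barriers give for such functions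
    a maximum principle in narrow layers ([supersol_narrow]) and a strong maximum
    principle of Hopf type ([supersol_hopf]).

    Take c = s e with a unit vector e. For small s the cap is narrow, so
    phi_c >= phi there ([kelvin_above_small]). The set of s with this property is
    closed, and it is open since phi_c > phi inside the cap
    ([kelvin_above_strict], [kelvin_above_open]); so it contains all s > 0
    ([kelvin_above_all]). As s tends to infinity this becomes phi(x) <= phi(x')
    for the reflection x' of any x with e.x > 0 ([reflection_le]); as e is
    arbitrary, phi is radial.

    The fixed sphere of the inversion meets the axis at r e, where r runs over (0, 1)
    as s varies. There the Hopf estimate bounds phi_c - phi from below linearly, and
    since (1 + r^2)^((N-2)/2) phi(r) is transported by the inversions, its derivative
    at r is negative as soon as it exists ([axis_derivative_lt0]).

    It exists because Delta u is bounded off the centre uniformly in time: f varies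
    by a bounded amount over the ball, so if Delta u were large somewhere it would be
    large on a whole ball ([lap_bounded]). Thus phi is a bounded-Laplacian function in
    the sense of touching from both sides, and being radial and Lipschitz along radii
    it has bounded second differences as a function of |x|^2 ([chord_lower],
    [derivable_of_second_diff]). *)

Set Implicit Arguments.
Unset Strict Implicit.
Unset Printing Implicit Defensive.

Import Order.TTheory GRing.Theory Num.Theory.
Import numFieldNormedType.Exports.

Local Open Scope classical_set_scope.
Local Open Scope ring_scope.

(** * Euclidean geometry of row vectors *)

Section Euclid.
Variables (R : realType) (N : nat).
Implicit Types x y z : 'rV[R]_N.

Definition dot x y : R := \sum_(i < N) x 0 i * y 0 i.

Lemma dotC x y : dot x y = dot y x.
Proof. by apply: eq_bigr => i _; rewrite mulrC. Qed.

Lemma dotDl x y z : dot (x + y) z = dot x z + dot y z.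
Proof. by rewrite /dot -big_split; apply: eq_bigr => i _; rewrite mxE mulrDl. Qed.

Lemma dotZl (a : R) x y : dot (a *: x) y = a * dot x y.
Proof. by rewrite /dot mulr_sumr; apply: eq_bigr => i _; rewrite mxE mulrA. Qed.

Lemma dotNl x y : dot (- x) y = - dot x y.
Proof. by rewrite -scaleN1r dotZl mulN1r. Qed.

Lemma dotDr x y z : dot x (y + z) = dot x y + dot x z.
Proof. by rewrite dotC dotDl !(dotC x). Qed.

Lemma dotZr (a : R) x y : dot x (a *: y) = a * dot x y.
Proof. by rewrite dotC dotZl dotC. Qed.

Lemma dotNr x y : dot x (- y) = - dot x y.
Proof. by rewrite dotC dotNl dotC. Qed.

Definition dotE := (dotDl, dotDr, dotNl, dotNr, dotZl, dotZr).

Lemma dot_ge0 x : 0 <= dot x x.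
Proof. by apply: sumr_ge0 => i _; rewrite -expr2 sqr_ge0. Qed.

Lemma dot0l x : dot 0 x = 0.
Proof. by rewrite -(scale0r 0) dotZl mul0r. Qed.

Lemma dotxx_eq0 x : (dot x x == 0) = (x == 0).
Proof.
apply/eqP/eqP => [x0|->]; last exact: dot0l.
apply/rowP => i; rewrite mxE; apply/eqP; rewrite -sqrf_eq0 expr2; apply/eqP.
by apply: (psumr_eq0P _ x0) => // j _; rewrite -expr2 sqr_ge0.
Qed.

Lemma dotxx_gt0 x : (0 < dot x x) = (x != 0).
Proof. by rewrite lt_def dot_ge0 andbT dotxx_eq0. Qed.

Lemma enormE x : enorm x = Num.sqrt (dot x x).
Proof. by congr Num.sqrt; apply: eq_bigr => i _; rewrite expr2. Qed.

Lemma enorm_sqr x : enorm x ^+ 2 = dot x x.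
Proof. by rewrite enormE sqr_sqrtr// dot_ge0. Qed.

Lemma enorm_ge0 x : 0 <= enorm x.
Proof. by rewrite enormE sqrtr_ge0. Qed.

Lemma enorm_ltP x (r : R) : 0 <= r -> (enorm x < r) = (dot x x < r ^+ 2).
Proof. by move=> r0; rewrite -enorm_sqr ltr_pXn2r ?nnegrE ?enorm_ge0. Qed.

Lemma enorm_leP x (r : R) : 0 <= r -> (enorm x <= r) = (dot x x <= r ^+ 2).
Proof. by move=> r0; rewrite -enorm_sqr ler_pXn2r ?nnegrE ?enorm_ge0. Qed.

Lemma unit_ballE x : unit_ball R N x <-> dot x x < 1.
Proof. by rewrite /unit_ball /= enorm_ltP// expr1n. Qed.

Lemma unit_cballE x : unit_cball R N x <-> dot x x <= 1.
Proof. by rewrite /unit_cball /= enorm_leP// expr1n. Qed.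

Lemma dot_delta x i : dot x (delta_mx 0 i) = x 0 i.
Proof.
rewrite /dot (bigD1 i)//= big1 ?addr0; first by rewrite mxE !eqxx mulr1.
by move=> j /negPf ji; rewrite mxE eqxx ji mulr0.
Qed.

Lemma coord_le_norm x i : `|x 0 i| <= `|x|.
Proof.
by rewrite [leRHS]/Num.Def.normr/= mx_normrE (le_trans _ (le_bigmax _ _ (0, i))).
Qed.

Lemma coord_sqr_le_dot x i : x 0 i ^+ 2 <= dot x x.
Proof.
rewrite /dot (bigD1 i)//= -expr2 lerDl; apply: sumr_ge0 => j _.
by rewrite -expr2 sqr_ge0.
Qed.

Lemma norm_le_enorm x : `|x| <= enorm x.
Proof.
rewrite [leLHS]/Num.Def.normr/= mx_normrE bigmax_le ?enorm_ge0// => -[i j] _ /=.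
rewrite ord1 -ler_sqr ?nnegrE ?enorm_ge0// real_normK ?num_real// enorm_sqr.
exact: coord_sqr_le_dot.
Qed.

Lemma cvg_dot (T : Type) (F : set_system T) {FF : Filter F}
    (f g : T -> 'rV[R]_N) x y :
  f t @[t --> F] --> x -> g t @[t --> F] --> y ->
  dot (f t) (g t) @[t --> F] --> dot x y.
Proof.
move=> cf cg; rewrite /dot; apply: cvg_big => [|i _]; first exact: add_continuous.
have co (h : T -> 'rV[R]_N) z : h t @[t --> F] --> z ->
    h t 0 i @[t --> F] --> z 0 i.
  move=> ch; exact: (@cvg_comp _ _ _ h (fun v : 'rV[R]_N => v 0 i) _ _ _ ch
    (@coord_continuous R 1 N 0 i z)).
by apply: cvgM; apply: co.
Qed.

Lemma cvg_shift y x : (z - y) @[z --> x] --> x - y.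
Proof. exact: (cvgB (@cvg_id _ (nbhs x)) (cvg_cst y)). Qed.

Lemma dot_shift_continuous y : continuous (fun x => dot (x - y) (x - y)).
Proof. by move=> x; exact: (cvg_dot (@cvg_shift y x) (@cvg_shift y x)). Qed.

Lemma dotl_continuous y : continuous (fun x => dot y x).
Proof. by move=> x; exact: (cvg_dot (cvg_cst y) (@cvg_id _ (nbhs x))). Qed.

Lemma dotxx_continuous : continuous (fun x => dot x x).
Proof.
by move=> x; exact: (cvg_dot (@cvg_id _ (nbhs x)) (@cvg_id _ (nbhs x))).
Qed.

(** The bound is on the Euclidean square, which dominates that of the sup norm
    ([norm_le_enorm]). *)
Lemma closed_bounded_compact (A : set 'rV[R]_N) (r : R) : closed A ->
  (forall x, A x -> dot x x <= r) -> compact A.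
Proof.
move=> cA bA; apply: bounded_closed_compact => //.
exists (Num.sqrt r); split; first exact: num_real.
move=> s rs x Ax; apply: le_trans (norm_le_enorm x) _.
by rewrite enormE (le_trans _ (ltW rs))// ler_wsqrtr// bA.
Qed.

Lemma closed_ball_compact y (r : R) : compact [set x | dot (x - y) (x - y) <= r].
Proof.
apply: (@closed_bounded_compact _ (2 * r + 2 * dot y y)).
  apply: (@closed_comp _ _ (fun x => dot (x - y) (x - y)) [set z | z <= r]).
    by move=> x _; exact: dot_shift_continuous.
  exact: closed_le.
move=> x /= xr; have := dot_ge0 (x - 2 *: y); move: xr.
by rewrite !dotE (dotC y x); lra.
Qed.

End Euclid.

(** * Directional derivatives *)

(** Derivation rules in lambda form: the derivative of a compound expression is
    then a term built along this expression. *)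
Section DeriveLambda.
Variables (R : realType) (V : normedModType R).
Implicit Types x v : V.

Lemma is_derive_funD (f g : V -> R) x v a b : is_derive x v f a -> is_derive x v g
  b ->
  is_derive x v (fun y => f y + g y) (a + b).
Proof. by move=> df dg; exact: is_deriveD. Qed.

Lemma is_derive_funN (f : V -> R) x v a : is_derive x v f a ->
  is_derive x v (fun y => - f y) (- a).
Proof. by move=> df; exact: is_deriveN. Qed.

Lemma is_derive_funM (f g : V -> R) x v a b : is_derive x v f a -> is_derive x v g
  b ->
  is_derive x v (fun y => f y * g y) (f x * b + g x * a).
Proof. by move=> df dg; exact: is_deriveM. Qed.

Lemma is_derive_funZ (k : R) (f : V -> R) x v a : is_derive x v f a ->
  is_derive x v (fun y => k * f y) (k * a).
Proof. by move=> df; exact: is_deriveZ. Qed.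

Lemma is_derive_funC (k : R) x v : is_derive x v (fun=> k) 0.
Proof. exact: is_derive_cst. Qed.

Lemma is_derive_fun_id (x : R) : is_derive x 1 (fun y : R => y) 1.
Proof. exact: is_derive_id. Qed.

End DeriveLambda.

(** * The Laplacian as a relation *)

Section Calculus.
Variables (R : realType) (N : nat).
Notation V := 'rV[R]_N.
Notation e_ i := (delta_mx 0 i : V).
Implicit Types x y v : V.

Lemma nearT x (P : set V) : (forall y, P y) -> \forall y \near x, P y.
Proof. by move=> aP; exact: (@filterS _ (nbhs x) (nbhs_filter x) setT P (fun y _ =>
  aP y) filterT). Qed.

Lemma nearS x (P Q : set V) :
  (forall y, P y -> Q y) -> (\forall y \near x, P y) -> \forall y \near x, Q y.
Proof. exact: (@filterS _ (nbhs x) (nbhs_filter x)). Qed.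

Lemma nearS2 x (P Q S : set V) : (forall y, P y -> Q y -> S y) ->
  (\forall y \near x, P y) -> (\forall y \near x, Q y) -> \forall y \near x, S y.
Proof. exact: (@filterS2 _ (nbhs x) (nbhs_filter x)). Qed.

Lemma is_derive_lineP (f : V -> R) x v (s d : R) :
  is_derive (s *: v + x) v f d <-> is_derive s 1 (fun h : R => f (h *: v + x)) d.
Proof.
have E : (fun h : R => h^-1 *: ((f \o shift (s *: v + x)) (h *: v) - f (s *: v + x)))
   = (fun h : R => h^-1 *: (((fun h : R => f (h *: v + x)) \o shift s) (h *: 1) -
       (fun h : R => f (h *: v + x)) s)).
  by apply/funext => h /=; rewrite [h *: 1]mulr1 scalerDl addrA.
by split=> -[d1 d2]; split; move: d1 d2; rewrite /derivable /derive E.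
Qed.

Lemma is_derive_line0P (f : V -> R) x v (d : R) :
  is_derive x v f d <-> is_derive (0 : R) 1 (fun h : R => f (h *: v + x)) d.
Proof. by rewrite -is_derive_lineP scale0r add0r. Qed.

Lemma near_line x v (P : set V) :
  (\forall y \near x, P y) -> \forall h \near (0 : R), P (h *: v + x).
Proof.
move=> Px; have c : (h *: v + x) @[h --> (0 : R)] --> x.
  rewrite -[X in _ --> X]add0r -(scale0r v).
  by apply: cvgD; [apply: cvgZr_tmp; exact: cvg_id|exact: cvg_cst].
exact: c Px.
Qed.

Lemma is_derive_continuous1 (f : R -> R) (a d : R) :
  is_derive a 1 f d -> {for a, continuous f}.
Proof.
by move=> [df _]; apply/differentiable_continuous/derivable1_diffP.
Qed.

(** If the second derivative were negative, the first one, which vanishes at the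
    minimum, would be negative just to its right, and the function would
    decrease there by the mean value theorem. *)
Lemma second_derivative_min (g g1 : R -> R) (g2 : R) :
  (\forall h \near (0 : R), is_derive (h : R) 1 g (g1 h)) ->
  is_derive (0 : R) 1 g1 g2 ->
  (\forall h \near (0 : R), g 0 <= g h) -> 0 <= g2.
Proof.
move=> dg dg1 gmin; rewrite leNgt; apply/negP => g2lt0.
have [r /= r0 Hr] : \forall h \near (0:R), is_derive (h : R) 1 g (g1 h) /\ g 0 <= g h.
  by apply: filterS2 dg gmin => h.
have Hr' h : `|h| < r -> is_derive (h : R) 1 g (g1 h) /\ g 0 <= g h.
  by move=> hr; apply: Hr; rewrite /ball_/= sub0r normrN.
have g10 : g1 0 = 0.
  have D0 : is_derive (0 : R) 1 g 0.
    apply: (@derive1_at_min R g (- r) r 0); first lra.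
    - move=> t; rewrite in_itv/= => /andP[t1 t2].
      by have [[]] := Hr' t ltac:(by rewrite ltr_norml t1 t2).
    - by rewrite in_itv/=; lra.
    - move=> t; rewrite in_itv/= => /andP[t1 t2].
      by have [_] := Hr' t ltac:(by rewrite ltr_norml t1 t2).
  have [D1 _] := Hr' 0 ltac:(by rewrite normr0).
  by rewrite -(@derive_val _ _ _ _ _ _ _ D1) (@derive_val _ _ _ _ _ _ _ D0).
have [dg1' dg1E] := dg1.
have C : h^-1 *: ((g1 \o shift (0 : R)) (h *: 1) - g1 0) @[h --> 0^'] --> g2.
  by rewrite -dg1E; exact: dg1'.
have [s /= s0 Hs] := cvgr_lt _ C 0 g2lt0.
have [m [m0 mr ms]] : exists m, [/\ 0 < m, m < r & m < s].
  exists (Num.min r s / 2); split.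
  - by rewrite divr_gt0 // lt_min r0 s0.
  - by rewrite ltr_pdivrMr// gt_min; apply/orP; left; lra.
  - by rewrite ltr_pdivrMr// gt_min; apply/orP; right; lra.
have [||c] := @MVT R g g1 0 m m0.
- move=> t; rewrite in_itv/= => /andP[t0 tm].
  by have [] := Hr' t ltac:(by rewrite gtr0_norm//; lra).
- apply: derivable_within_continuous => t; rewrite in_itv/= => /andP[t0 tm].
  by have [[]] := Hr' t ltac:(by rewrite ger0_norm//; lra).
rewrite in_itv/= => /andP[c0 cm]; rewrite subr0 => E.
have := Hs c; rewrite /ball_/= sub0r normrN gtr0_norm// => /(_ ltac:(lra)).
rewrite gt_eqF// => /(_ isT); rewrite [c *: 1]mulr1 addr0 g10 subr0.
rewrite [_ *: _]/(_ * _) pmulr_rlt0 ?invr_gt0// => g1c.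
have [_] := Hr' m ltac:(by rewrite gtr0_norm//).
by rewrite -subr_ge0 E leNgt nmulr_rlt0// m0.
Qed.

(** A relation that carries its witnesses: the first derivatives are recorded on
    a neighbourhood and the pure second ones at the point only. Sums, multiples
    and the test at a minimum then need no rewriting of derivative operators. *)
Definition has_lap (g : V -> R) x (l : R) :=
  exists (g1 : 'I_N -> V -> R) (g2 : 'I_N -> R),
  [/\ forall i, \forall y \near x, is_derive y (e_ i) g (g1 i y),
      forall i, is_derive x (e_ i) (g1 i) (g2 i) &
      l = \sum_i g2 i].

Lemma has_lap_cst (a : R) x : has_lap (cst a) x 0.
Proof.
exists (fun _ _ => 0), (fun=> 0); split.
- by move=> i; apply: nearT => y; exact: is_derive_cst.
- by move=> i; exact: is_derive_cst.
- by rewrite big1.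
Qed.

Lemma has_lapD (f g : V -> R) x a b :
  has_lap f x a -> has_lap g x b -> has_lap (fun y => f y + g y) x (a + b).
Proof.
move=> [f1 [f2 [F1 F2 ->]]] [g1 [g2 [G1 G2 ->]]].
exists (fun i y => f1 i y + g1 i y), (fun i => f2 i + g2 i); split.
- by move=> i; apply: nearS2 (F1 i) (G1 i) => y df dg; exact: is_deriveD.
- by move=> i; exact: is_deriveD.
- by rewrite big_split.
Qed.

Lemma has_lapZ (k : R) (f : V -> R) x a :
  has_lap f x a -> has_lap (fun y => k * f y) x (k * a).
Proof.
move=> [f1 [f2 [F1 F2 ->]]].
exists (fun i y => k * f1 i y), (fun i => k * f2 i); split.
- by move=> i; apply: nearS (F1 i) => y df; exact: is_deriveZ.
- by move=> i; exact: is_deriveZ.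
- by rewrite mulr_sumr.
Qed.

Lemma has_lapN (f : V -> R) x a : has_lap f x a -> has_lap (fun y => - f y) x (- a).
Proof.
by move=> /(has_lapZ (-1)); rewrite mulN1r; under eq_fun do rewrite mulN1r.
Qed.

Lemma has_lapB (f g : V -> R) x a b :
  has_lap f x a -> has_lap g x b -> has_lap (fun y => f y - g y) x (a - b).
Proof. by move=> fa /has_lapN; exact: has_lapD. Qed.

(** The maximum principle in its raw form: each pure second derivative is
    nonnegative at a local minimum. *)
Lemma has_lap_min (g : V -> R) x l :
  has_lap g x l -> (\forall y \near x, g x <= g y) -> 0 <= l.
Proof.
move=> [g1 [g2 [G1 G2 ->]]] gmin; apply: sumr_ge0 => i _.
apply: (@second_derivative_min (fun h => g (h *: e_ i + x))
  (fun h => g1 i (h *: e_ i + x))).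
- by apply: filterS (near_line (e_ i) (G1 i)) => h /is_derive_lineP.
- exact/is_derive_line0P.
- by rewrite scale0r add0r; exact: (near_line (e_ i) gmin).
Qed.

Lemma is_derive_coord j x v : is_derive x v (fun y : V => y 0 j) (v 0 j).
Proof.
apply/is_derive_line0P.
have -> : (fun h : R => (h *: v + x) 0 j) =
    (v 0 j \*: (id : R -> R)) + cst (x 0 j) :> (R -> R).
  by apply/funext => h; rewrite !mxE mulrC.
have := is_deriveD (is_deriveZ (v 0 j) (is_derive_id (0 : R) 1))
                   (is_derive_cst (x 0 j) (0 : R) 1).
by rewrite addr0 [_ *: _]mulr1.
Qed.

Lemma is_derive_dot_shift y x v :
  is_derive x v (fun z : V => dot (z - y) (z - y)) (2 * dot (x - y) v).
Proof.
have -> : (fun z : V => dot (z - y) (z - y)) =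
   \sum_(i < N) ((fun z : V => z 0 i) - cst (y 0 i)) ^+ 2.
  by apply/funext => z; rewrite fct_sumE; apply: eq_bigr => i _; rewrite !mxE expr2.
apply: (@is_derive_eq _ _ _ _ _ _ _ (\sum_(i < N) (2 * (x 0 i - y 0 i)) * v 0 i)).
  apply: is_derive_sum => i.
  have D := is_deriveB (is_derive_coord i x v) (is_derive_cst (y 0 i) x v).
  by have := is_deriveX 2 D; rewrite subr0 expr1.
by rewrite /dot mulr_sumr; apply: eq_bigr => i _; rewrite !mxE mulrA.
Qed.

Lemma is_derive_comp1 (f : V -> R) (G : R -> R) x v a b :
  is_derive x v f a -> is_derive (f x) 1 G b -> is_derive x v (G \o f) (b * a).
Proof.
move=> /is_derive_line0P df dG; apply/is_derive_line0P.
apply: (@is_derive1_comp _ G (fun h => f (h *: v + x))) => //.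
by rewrite scale0r add0r.
Qed.

End Calculus.

(** * Chain rule along coordinate directions *)

Section ChainRule.
Variables (R : realType) (N : nat).
Notation V := 'rV[R]_N.
Notation e_ i := (delta_mx 0 i : V).
Implicit Types x y v : V.

Lemma is_derive_fun_sum (f : 'I_N -> V -> R) x v (a : 'I_N -> R) :
  (forall i, is_derive x v (f i) (a i)) ->
  is_derive x v (fun y => \sum_i f i y) (\sum_i a i).
Proof.
move=> df; have -> : (fun y => \sum_i f i y) = \sum_i f i.
  by apply/funext => y; rewrite fct_sumE.
exact: is_derive_sum.
Qed.

Lemma is_derive_funV (f : V -> R) x v a : f x != 0 -> is_derive x v f a ->
  is_derive x v (fun y => (f y)^-1) (- (f x) ^- 2 * a).
Proof.
move=> fx df.
have fx' : f (0 *: v + x) != 0 by rewrite scale0r add0r.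
move: (df) => /is_derive_line0P /(@is_deriveV R (fun h => f (h *: v + x)) 0 a 1 fx').
by rewrite scale0r add0r => H; apply/is_derive_line0P.
Qed.

Lemma is_derive_scale_dir (f : V -> R) x v (a d : R) :
  is_derive x v f d -> is_derive x (a *: v) f (a * d).
Proof.
move=> /is_derive_line0P df; apply/is_derive_line0P.
have -> : (fun h : R => f (h *: (a *: v) + x)) =
    (fun h : R => f (h *: v + x)) \o (fun h => a * h).
  by apply/funext => h /=; rewrite scalerA mulrC.
rewrite mulrC; apply: is_derive1_comp; first by rewrite mulr0.
by have := is_deriveZ a (is_derive_id (0 : R) 1); rewrite [_ *: 1]mulr1.
Qed.

(** All barriers and test functions below are functions of a squared distance,
    and this is the only computation of a Laplacian that they require. *)
Lemma has_lap_radial (G G1 : R -> R) (b : R) y x :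
  (\forall p \near (dot (x - y) (x - y)), is_derive (p : R) 1 G (G1 p)) ->
  is_derive (dot (x - y) (x - y)) 1 G1 b ->
  has_lap (fun z => G (dot (z - y) (z - y))) x
    (4 * dot (x - y) (x - y) * b + 2 * N%:R * G1 (dot (x - y) (x - y))).
Proof.
move=> dG dG1.
exists (fun i z => G1 (dot (z - y) (z - y)) * (2 * (z - y) 0 i)),
  (fun i => G1 (dot (x - y) (x - y)) * 2 +
            2 * (x - y) 0 i * (b * (2 * (x - y) 0 i))); split.
- move=> i; have := @dot_shift_continuous R N y x _ dG.
  apply: nearS => z Hz; rewrite -dot_delta.
  exact: (is_derive_comp1 (is_derive_dot_shift y z (e_ i)) Hz).
- move=> i; apply: is_derive_funM.
    by rewrite -dot_delta; exact: (is_derive_comp1 (is_derive_dot_shift y x (e_ i))).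
  have -> : (fun z : V => 2 * (z - y) 0 i) = (fun z => 2 * (z 0 i + - y 0 i)).
    by apply/funext => z; rewrite !mxE.
  rewrite -[X in is_derive _ _ _ X]mulr1; apply: is_derive_funZ; rewrite -[X in
    is_derive _ _ _ X]addr0.
  apply: is_derive_funD (is_derive_funC _ _ _).
  by have := is_derive_coord i x (e_ i); rewrite mxE !eqxx.
- rewrite big_split/= sumr_const card_ord -mulr_natr.
  rewrite [X in _ = _ + X](_ : _ = 4 * dot (x - y) (x - y) * b); first ring.
  rewrite /dot mulrAC mulr_sumr; apply: eq_bigr => i _; ring.
Qed.

(** Move from x to h + x one coordinate at a time: along each edge of this
    path the mean value theorem replaces the increment by a partial derivative
    at a nearby point, which continuity compares with its value at x. *)
Lemma partials_small_o (g : V -> R) (g1 : 'I_N -> V -> R) x (eta : R) : 0 < eta ->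
  (forall i, \forall y \near x, is_derive y (e_ i) g (g1 i y)) ->
  (forall i, {for x, continuous (g1 i)}) ->
  \forall h \near (0 : V),
   `|g (h + x) - g x - \sum_i h 0 i * g1 i x| <= N%:R * (eta * `|h|).
Proof.
move=> eta0 dg cg.
have [d /= d0 Hd] : exists2 d : R, 0 < d & forall y, `|y - x| < d -> forall i,
    is_derive y (e_ i) g (g1 i y) /\ `|g1 i y - g1 i x| < eta.
  have : \forall y \near x, forall i, is_derive y (e_ i) g (g1 i y) /\
       `|g1 i y - g1 i x| < eta.
    apply: (@filter_forall _ _ (fun i y => is_derive y (e_ i) g (g1 i y) /\
      `|g1 i y - g1 i x| < eta) (nbhs x) (nbhs_filter x)) => i.
    apply: nearS2 (dg i) ((cvgrPdist_lt _ _).1 (cg i) _ eta0) => y ? ?.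
    by split=> //; rewrite distrC.
  move=> /nbhs_ballP[d d0 Hd]; exists d => // y yd; apply: Hd.
  by rewrite -ball_normE /= distrC.
apply/nbhs_ballP; exists d => // h; rewrite -ball_normE /= sub0r normrN => hd.
(* the k-th vertex of the path along the coordinates *)
pose p (k : nat) : V := \row_i (if (i < k)%N then h 0 i else 0).
have pN : p N = h by apply/rowP => i; rewrite mxE ltn_ord.
have p0 : p 0%N = 0 by apply/rowP => i; rewrite !mxE.
have step (k : 'I_N) : p k.+1 = h 0 k *: e_ k + p k.
  apply/rowP => i; rewrite !mxE eqxx /= ltnS leq_eqVlt.
  have [->|ik] := eqVneq i k; first by rewrite eqxx ltnn mulr1 addr0.
  by rewrite -val_eqE/= in ik; rewrite (negPf ik) mulr0 add0r.
have bnd (k : 'I_N) (s : R) : 0 <= s <= 1 -> `|s *: (h 0 k *: e_ k) + p k| < d.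
  move=> /andP[s0 s1]; apply: le_lt_trans hd.
  rewrite [leLHS]/Num.Def.normr/= mx_normrE bigmax_le// => -[i j] _ /=.
  rewrite ord1 !mxE eqxx /=.
  have [->|jk] := eqVneq j k.
    rewrite ltnn addr0 mulr1 normrM (ger0_norm s0).
    by apply: le_trans (coord_le_norm h k); rewrite ler_piMl.
  rewrite !mulr0 add0r; case: ifP => _; first exact: coord_le_norm.
  by rewrite normr0.
have main k : (k <= N)%N ->
    `|g (p k + x) - g x - \sum_(i < N | (i < k)%N) h 0 i * g1 i x|
     <= k%:R * (eta * `|h|).
  elim: k => [_|k IH kN].
    by rewrite big_pred0// p0 add0r mul0r subrr subr0 normr0.
  pose K := Ordinal kN.
  have sumE : \sum_(i < N | (i < k.+1)%N) h 0 i * g1 i x =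
      \sum_(i < N | (i < k)%N) h 0 i * g1 i x + h 0 K * g1 K x.
    rewrite (bigD1 K)//= addrC; congr (_ + _); apply: eq_bigl => i.
    by rewrite ltnS -val_eqE /= andbC ltn_neqAle.
  pose v := h 0 K *: e_ K.
  have dphi (s : R) : 0 <= s <= 1 ->
      is_derive s 1 (fun s => g (s *: v + (p k + x)))
        (h 0 K * g1 K (s *: v + (p k + x))).
    move=> s01; apply/is_derive_lineP; apply: is_derive_scale_dir.
    by have [] := Hd (s *: v + (p k + x)) ltac:(by rewrite addrA addrK; exact: (bnd
      K)) K.
  have D (s : R) : s \in `]0, 1[%R -> is_derive s 1 (fun s => g (s *: v + (p k + x)))
        (h 0 K * g1 K (s *: v + (p k + x))).
    by rewrite in_itv/= => /andP[s0 s1]; apply: dphi; rewrite !ltW.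
  have Cn : {within `[0, 1], continuous (fun s : R => g (s *: v + (p k + x)))}.
    by apply: derivable_within_continuous => s; rewrite in_itv/= => /dphi[].
  have [c] := MVT ltr01 D Cn.
  rewrite in_itv/= => /andP[c0 c1].
  rewrite scale1r scale0r add0r subr0 mulr1 addrA -step => E.
  have [_ cl] := Hd (c *: v + (p k + x))
    ltac:(by rewrite addrA addrK; apply: (bnd K); rewrite !ltW) K.
  rewrite sumE.
  have -> : g (p k.+1 + x) - g x - (\sum_(i < N | (i < k)%N) h 0 i * g1 i x + h 0 K
    * g1 K x)
     = (g (p k + x) - g x - \sum_(i < N | (i < k)%N) h 0 i * g1 i x) +
       h 0 K * (g1 K (c *: v + (p k + x)) - g1 K x).
    by rewrite mulrBr -E; ring.
  rewrite (le_trans (ler_normD _ _))// -natr1 mulrDl mul1r lerD// ?IH 1?ltnW//.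
  by rewrite normrM mulrC ler_pM// ?coord_le_norm// ltW.
rewrite (eq_bigl (fun i : 'I_N => (i < N)%N)) => [|i]; last by rewrite ltn_ord.
by rewrite -[in g (h + x)]pN; exact: main.
Qed.

Lemma partials_differentiable (g : V -> R) (g1 : 'I_N -> V -> R) x :
  (forall i, \forall y \near x, is_derive y (e_ i) g (g1 i y)) ->
  (forall i, {for x, continuous (g1 i)}) ->
  differentiable g x /\ forall v, 'd g x v = \sum_i v 0 i * g1 i x.
Proof.
move=> dg cg.
pose w : V := \row_i g1 i x.
have lin : linear ((fun v => dot v w) : V -> R) by move=> a u v; rewrite !dotE.
pose lM := GRing.isLinear.Build R V R _ _ lin.
pose L : {linear V -> R} := HB.pack ((fun v => dot v w) : V -> R) lM.
have cL : continuous L.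
  move=> z; rewrite /L /=; exact: (cvg_dot (@cvg_id _ (nbhs z)) (cvg_cst w)).
have LE v : L v = \sum_i v 0 i * g1 i x.
  by rewrite /L /= /dot; apply: eq_bigr => i _; rewrite mxE.
have small eps : 0 < eps -> \forall h \near (0 : V),
    `|(g \o shift x - (cst (g x) + L)) h| <= eps * `|h|.
  move=> eps0; have N0 : 0 < N%:R + 1 :> R by rewrite ltr_wpDl.
  apply: nearS (partials_small_o (divr_gt0 eps0 N0) dg cg) => h.
  rewrite -LE => /le_trans; rewrite !fctE opprD addrA; apply.
  rewrite mulrA ler_wpM2r// mulrCA ler_piMr ?(ltW eps0)//.
  by rewrite ler_pdivrMr// mul1r lerDl.
have dE : 'd g x = L :> (V -> R).
  by apply: diff_unique => //; apply/eqaddoP => eps /small.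
split; last by move=> v; rewrite dE LE.
apply/diff_locallyP; rewrite dE; split => //.
by apply/eqaddoP => eps /small.
Qed.

(** The inner map is only required to have a directional derivative, which is
    what the coordinates of an inversion provide directly. *)
Lemma is_derive_comp_partials (g : V -> R) (g1 : 'I_N -> V -> R) (K : V -> V)
    (k : 'I_N -> R) x v :
  (forall i, \forall y \near (K x), is_derive y (e_ i) g (g1 i y)) ->
  (forall i, {for K x, continuous (g1 i)}) ->
  (forall j, is_derive x v (fun y => K y 0 j) (k j)) ->
  is_derive x v (g \o K) (\sum_j k j * g1 j (K x)).
Proof.
move=> dg cg dK; have [diffg dE] := partials_differentiable dg cg.
apply/is_derive_line0P.
pose gam (h : R) := K (h *: v + x).
have gam0 : gam 0 = K x by rewrite /gam scale0r add0r.
have dgam j : is_derive (0 : R) 1 (fun h => gam h 0 j) (k j).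
  exact/(is_derive_line0P (fun y => K y 0 j)).
have Dg : derivable gam (0 : R) 1.
  by apply/derivable_mxP => i j; rewrite ord1; have [] := dgam j.
have diffgam : differentiable gam (0 : R) by exact/derivable1_diffP.
have diffg' : differentiable g (gam 0) by rewrite gam0.
have -> : (fun h : R => (g \o K) (h *: v + x)) = g \o gam by [].
split; first by apply/derivable1_diffP; exact: differentiable_comp.
rewrite deriveE; last exact: differentiable_comp.
have -> : 'd (g \o gam) (0 : R) 1 = 'd g (gam 0) ('d gam (0 : R) 1).
  by have := congr1 (fun h => h 1) (diff_comp diffgam diffg').
rewrite -(deriveE _ diffgam) gam0 dE (derive_mx Dg).
by apply: eq_bigr => j _; rewrite mxE (@derive_val _ _ _ _ _ _ _ (dgam j)).
Qed.

End ChainRule.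

(** * Inversions and the Kelvin transform *)

Section Kelvin.
Variables (R : realType) (N : nat).
Notation V := 'rV[R]_N.
Notation e_ i := (delta_mx 0 i : V).
Implicit Types x y v : V.

(** Classical second-order regularity on an open set, with the first and second
    derivatives as data: u1 i is the derivative along the i-th axis, and u2 i j
    differentiates u1 i along the j-th one. *)
Definition C2on (O : set V) (u : V -> R) (u1 : 'I_N -> V -> R)
    (u2 : 'I_N -> 'I_N -> V -> R) : Prop := forall y, O y ->
  [/\ forall i, is_derive y (e_ i) u (u1 i y),
      forall i j, is_derive y (e_ j) (u1 i) (u2 i j y),
      forall i, {for y, continuous (u1 i)} &
      forall i j, {for y, continuous (u2 i j)}].

Lemma C2on_lap O u u1 u2 y : open O -> C2on O u u1 u2 -> O y ->
  has_lap u y (\sum_i u2 i i y).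
Proof.
move=> oO hu Oy; exists u1, (fun i => u2 i i y); split=> //.
- move=> i; have : \forall z \near y, O z by exact: open_nbhs_nbhs.
  by apply: nearS => z /hu[].
- by move=> i; have [_ + _ _] := hu y Oy; apply.
Qed.

Variable c : V.

(** The inversion of centre -c and power kap c = 1 + |c|^2. Its fixed sphere cuts
    the unit sphere along the great sphere orthogonal to c; under stereographic
    projection it is the reflection in a hyperplane through the centre of S^N. *)
Definition kap : R := 1 + dot c c.
Definition sqd x : R := dot (x - - c) (x - - c).
(** The conformal factor of the inversion: its differential at x is mu x times a
    reflection. *)
Definition mu x : R := kap / sqd x.
Definition invc x : V := mu x *: (x + c) - c.
Definition kelvin (u : V -> R) x : R :=
  mu x `^ ((N%:R - 2) / 2) * u (invc x).

Lemma kap_gt0 : 0 < kap.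
Proof. by rewrite /kap ltr_wpDr// dot_ge0. Qed.

Lemma kap_ge1 : 1 <= kap.
Proof. by rewrite /kap lerDl dot_ge0. Qed.

Lemma sqdE x : sqd x = dot x x + 2 * dot c x + dot c c.
Proof. by rewrite /sqd opprK !dotE (dotC x c); ring. Qed.

Lemma mu_gt0 x : 0 < sqd x -> 0 < mu x.
Proof. by move=> S0; rewrite divr_gt0// kap_gt0. Qed.

Lemma sqd_continuous : continuous sqd.
Proof. exact: dot_shift_continuous. Qed.

End Kelvin.

Section KelvinLimits.
Variables (R : realType) (N : nat).
Notation V := 'rV[R]_N.
Variables (T : Type) (F : set_system T).
Context {FF : Filter F}.
Variables (ct xt : T -> V) (c x : V).
Hypotheses (hc : ct t @[t --> F] --> c) (hx : xt t @[t --> F] --> x).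
Hypothesis (S0 : 0 < sqd c x).

Lemma cvg_sqd : sqd (ct t) (xt t) @[t --> F] --> sqd c x.
Proof.
have h : (xt t - - ct t) @[t --> F] --> x - - c by exact: (cvgB hx (cvgN hc)).
exact: (cvg_dot h h).
Qed.

Lemma cvg_mu : mu (ct t) (xt t) @[t --> F] --> mu c x.
Proof.
have h : kap (ct t) @[t --> F] --> kap c.
  exact: (cvgD (cvg_cst (1 : R)) (cvg_dot hc hc)).
exact: (cvgM h (cvgV (lt0r_neq0 S0) cvg_sqd)).
Qed.

Lemma cvg_invc : invc (ct t) (xt t) @[t --> F] --> invc c x.
Proof.
have h1 : (xt t + ct t) @[t --> F] --> x + c by exact: cvgD.
have h2 : (mu (ct t) (xt t) *: (xt t + ct t)) @[t --> F] --> mu c x *: (x + c).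
  exact: (cvgZ cvg_mu h1).
exact: (cvgB h2 hc).
Qed.

Lemma cvg_kelvin u : {for invc c x, continuous u} ->
  kelvin (ct t) u (xt t) @[t --> F] --> kelvin c u x.
Proof.
move=> cu.
have h : {for mu c x, continuous (fun a : R => a `^ ((N%:R - 2) / 2))}.
  exact: (is_derive_continuous1 (is_derive1_powR _ (mu_gt0 S0))).
have h1 : mu (ct t) (xt t) `^ ((N%:R - 2) / 2) @[t --> F] -->
    mu c x `^ ((N%:R - 2) / 2).
  exact: (@cvg_comp _ _ _ (fun t => mu (ct t) (xt t))
    (fun a : R => a `^ ((N%:R - 2) / 2)) _ _ _ cvg_mu h).
have h2 : u (invc (ct t) (xt t)) @[t --> F] --> u (invc c x).
  exact: (@cvg_comp _ _ _ (fun t => invc (ct t) (xt t)) u _ _ _ cvg_invc cu).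
exact: (cvgM h1 h2).
Qed.

End KelvinLimits.

Section KelvinLaplacian.
Variables (R : realType) (N : nat).
Notation V := 'rV[R]_N.
Notation e_ i := (delta_mx 0 i : V).
Implicit Types x y v : V.
Variable c : V.

Lemma invc_continuous x : 0 < sqd c x -> {for x, continuous (invc c)}.
Proof. by move=> S0; exact: (cvg_invc (cvg_cst c) (@cvg_id _ (nbhs x)) S0). Qed.

(* b is the weight that makes all first-order terms of the Laplacian cancel;
   z = x + c, q = |z|^-2 and P = mu^b are kept as atoms of the computation *)
Let b : R := (N%:R - 2) / 2.
Let z i x : R := x 0 i + c 0 i.
Let q x : R := (sqd c x)^-1.
Let P x : R := mu c x `^ b.

Let dz i j x : is_derive x (e_ i) (z j) (j == i)%:R.
Proof.
rewrite -[X in is_derive _ _ _ X]addr0; apply: is_derive_funD (is_derive_funC _ _ _).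
by have := is_derive_coord j x (e_ i); rewrite mxE eqxx /= eq_sym.
Qed.

Let dz1 i x : is_derive x (e_ i) (z i) 1.
Proof. by have := dz i i x; rewrite eqxx. Qed.

Let dq i x : 0 < sqd c x -> is_derive x (e_ i) q (- q x ^+ 2 * (2 * z i x)).
Proof.
move=> S0; have := is_derive_dot_shift (- c) x (e_ i).
rewrite dot_delta !mxE opprK => D.
by have := is_derive_funV (lt0r_neq0 S0) D; rewrite exprVn.
Qed.

Let dP i x : 0 < sqd c x -> is_derive x (e_ i) P (P x * (- 2 * b * z i x * q x)).
Proof.
move=> S0; have D := is_derive_funZ (kap c) (dq i S0).
have := is_derive_comp1 D (is_derive1_powR b (mu_gt0 S0)).
congr (is_derive _ _ _ _); rewrite /P /mu -/(q x) -[kap c / _]/(kap c * q x).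
have m0 : 0 < kap c * q x by exact: mu_gt0.
have -> : (kap c * q x) `^ (b - 1) = (kap c * q x) `^ b / (kap c * q x).
  by rewrite powRB ?powRr1 ?ltW// (gt_eqF m0) implybT.
field; rewrite /q !gt_eqF ?invr_gt0// ?kap_gt0//.
Qed.

Let dK i j x : 0 < sqd c x ->
  is_derive x (e_ i) (fun y => invc c y 0 j)
    (mu c x * ((j == i)%:R - 2 * z i x * q x * z j x)).
Proof.
move=> S0.
have -> : (fun y => invc c y 0 j) = (fun y => (kap c * q y) * z j y + - c 0 j).
  by apply/funext => y; rewrite !mxE.
have := is_derive_funD (is_derive_funM (is_derive_funZ (kap c) (dq i S0)) (dz i j
  x)) (is_derive_funC (- c 0 j) x (e_ i)).
by congr (is_derive _ _ _ _); rewrite /mu -/(q x); ring.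
Qed.

Let dcomp G (G1 : 'I_N -> V -> R) i x : 0 < sqd c x ->
  (forall j, \forall y \near invc c x, is_derive y (e_ j) G (G1 j y)) ->
  (forall j, {for invc c x, continuous (G1 j)}) ->
  is_derive x (e_ i) (fun y => G (invc c y))
    (mu c x * (G1 i (invc c x) - 2 * z i x * q x * \sum_j z j x * G1 j (invc c x))).
Proof.
move=> S0 dG cG.
have := is_derive_comp_partials dG cG (fun j => dK i j S0).
congr (is_derive _ _ _ _).
under eq_bigr do rewrite -mulrA mulrBl.
rewrite -mulr_sumr sumrB; congr (_ * (_ - _)).
  rewrite (bigD1 i)//= eqxx mul1r big1 ?addr0// => j /negPf ji.
  by rewrite ji mul0r.
by rewrite mulr_sumr; apply: eq_bigr => j _; rewrite -!mulrA.
Qed.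

(** Conformal covariance of the Laplacian. After two applications of the chain
    rule the i-th second derivative is a combination of six families of terms in
    z, the gradient and the Hessian of u at invc c x; summed over i, the terms
    in u and in its gradient cancel because b = (N - 2) / 2, and the terms in the
    radial part of the Hessian cancel each other. *)
Lemma has_lap_kelvin O u u1 u2 x : open O -> C2on O u u1 u2 ->
  0 < sqd c x -> O (invc c x) ->
  has_lap (kelvin c u) x
    (mu c x `^ ((N%:R - 2) / 2) * mu c x ^+ 2 * \sum_i u2 i i (invc c x)).
Proof.
move=> oO hu S0 Ox.
(* T is the radial derivative of u at the image point, up to a factor *)
pose T y := \sum_j z j y * u1 j (invc c y).
pose B i y := - 2 * b * (z i y * u (invc c y)) +
  kap c * (u1 i (invc c y) + - 2 * (z i y * q y * T y)).
have nearO y : O y -> \forall w \near y, O w by move=> Oy; exact: open_nbhs_nbhs.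
have nearx : \forall y \near x, 0 < sqd c y /\ O (invc c y).
  have h1 : \forall y \near x, 0 < sqd c y by exact: (cvgr_gt _ (@sqd_continuous R
    N c x)).
  have h2 : \forall y \near x, O (invc c y).
    exact: (invc_continuous S0 (nearO _ Ox)).
  by apply: nearS2 h1 h2 => y.
have du i y : 0 < sqd c y -> O (invc c y) -> is_derive y (e_ i) (fun y => u (invc c
  y))
    (mu c y * (u1 i (invc c y) - 2 * z i y * q y * T y)).
  move=> Sy Oy; apply: dcomp => // j; last by have [_ _ + _] := hu _ Oy; apply.
  by apply: nearS (nearO _ Oy) => w /hu[].
have du1 k i : is_derive x (e_ i) (fun y => u1 k (invc c y))
    (mu c x * (u2 k i (invc c x) - 2 * z i x * q x * \sum_j z j x * u2 k j (invc c
      x))).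
  apply: dcomp => // j; last by have [_ _ _] := hu _ Ox; apply.
  by apply: nearS (nearO _ Ox) => w /hu[].
pose A i := \sum_k z k x * u2 k i (invc c x).
pose C i := \sum_j z j x * u2 i j (invc c x).
pose Q := \sum_k z k x * C k.
pose tr := \sum_i u2 i i (invc c x).
have QA : \sum_i z i x * A i = Q.
  rewrite /Q /A; under eq_bigr do rewrite mulr_sumr.
  rewrite exchange_big /=; apply: eq_bigr => k _; rewrite mulr_sumr.
  by apply: eq_bigr => j _; rewrite mulrCA.
have dT i : is_derive x (e_ i) T
    (u1 i (invc c x) + mu c x * (A i - 2 * z i x * q x * Q)).
  have := is_derive_fun_sum (fun k => is_derive_funM (dz i k x) (du1 k i)).
  congr (is_derive _ _ _ _); rewrite big_split/= addrC; congr (_ + _).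
    rewrite (bigD1 i)//= eqxx mulr1 big1 ?addr0// => j /negPf ji.
    by rewrite ji mulr0.
  under eq_bigr => k _ do rewrite mulrCA mulrBr.
  rewrite -mulr_sumr sumrB; congr (_ * (_ - _)).
  by rewrite mulr_sumr; apply: eq_bigr => k _; rewrite mulrCA.
exists (fun i y => P y * q y * B i y).
set U := u (invc c x).
have dB i := is_derive_funD (is_derive_funZ (- 2 * b) (is_derive_funM (dz1 i x) (du
  i x S0 Ox)))
  (is_derive_funZ (kap c) (is_derive_funD (du1 i i) (is_derive_funZ (-2)
    (is_derive_funM (is_derive_funM (dz1 i x) (dq i S0)) (dT i))))).
have dF1 i := is_derive_funM (is_derive_funM (dP i S0) (dq i S0)) (dB i).
eexists; split; [ | by move=> i; exact: dF1 | ].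
  move=> i; apply: nearS nearx => y [Sy Oy].
  have := is_derive_funM (dP i Sy) (du i y Sy Oy).
  by congr (is_derive _ _ _ _); rewrite /B /mu -/(q y); ring.
pose m := kap c * q x.
have mE : mu c x = m by [].
pose c0 := P x * q x * (- 2 * b * U - 2 * kap c * T x * q x).
pose c1 := P x * q x * (4 * b * m * q x * T x + 4 * kap c * m * q x ^+ 2 * Q +
    4 * kap c * T x * q x ^+ 2) + 4 * b * U * P x * q x ^+ 2 * (1 + b) +
    4 * kap c * q x * T x * P x * q x ^+ 2 * (1 + b).
pose c2 := P x * q x * (- 2 * b * m - 2 * kap c * q x)
           - 2 * kap c * P x * q x ^+ 2 * (1 + b).
pose c3 := P x * q x * kap c * m.
(* the i-th term, sorted by its dependence on i *)
transitivity (\sum_i (c0 + c1 * (z i x * z i x) + c2 * (z i x * u1 i (invc c x)) +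
   c3 * u2 i i (invc c x) - 2 * q x * c3 * (z i x * C i) -
   2 * q x * c3 * (z i x * A i))); last first.
  by apply: eq_bigr => i _; rewrite /B -/U mE -/(C i) /c0 /c1 /c2 /c3; ring.
rewrite !big_split/= !sumrN -!mulr_sumr QA -/Q -/tr.
have -> : \sum_(i < N) (- 2 * b * U - 2 * kap c * T x * q x) =
    N%:R * (- 2 * b * U - 2 * kap c * T x * q x).
  by rewrite sumr_const card_ord; exact/esym/mulr_natl.
have -> : \sum_i z i x * z i x = sqd c x.
  by rewrite /sqd opprK /dot; apply: eq_bigr => i _; rewrite !mxE.
have -> : \sum_i z i x * u1 i (invc c x) = T x by [].
rewrite -[mu c x `^ _]/(P x) mE /c0 /c1 /c2 /c3 /m /q /b.
by field; rewrite gt_eqF.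
Qed.

End KelvinLaplacian.

(** * Supersolutions in the sense of touching *)

Section Supersolutions.
Variables (R : realType) (N : nat).
Notation V := 'rV[R]_N.
Notation e_ i := (delta_mx 0 i : V).
Implicit Types x y v : V.

Lemma near_dotP x0 (P : set V) : (\forall x \near x0, P x) ->
  exists2 r : R, 0 < r & forall x, dot (x - x0) (x - x0) <= r -> P x.
Proof.
move=> /nbhs_ballP[d /= d0 Hd]; exists ((d / 2) ^+ 2); first by rewrite exprn_gt0//
  divr_gt0.
move=> x; rewrite -enorm_leP ?divr_ge0 ?(ltW d0)// => xd; apply: Hd.
rewrite -ball_normE /= distrC (le_lt_trans (norm_le_enorm _))//.
by rewrite (le_lt_trans xd)// ltr_pdivrMr// ltr_pMr// ltr1n.
Qed.

Lemma near_dot_lt x0 x (r : R) : dot (x - x0) (x - x0) < r ->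
  \forall y \near x, dot (y - x0) (y - x0) < r.
Proof. by move=> xr; exact: (cvgr_lt _ (@dot_shift_continuous R N x0 x)). Qed.

Lemma has_lap_sqdist y x : has_lap (fun z => dot (z - y) (z - y)) x (2 * N%:R).
Proof.
rewrite -[2 * _]mulr1 -[X in has_lap _ _ X]add0r.
have := @has_lap_radial R N id (fun=> 1) 0 y x.
rewrite mulr0; apply; first by exists 1 => //= p _; exact: is_derive_id.
Qed.

(** W satisfies Delta W <= C |W| + D whenever it is touched from below: this
    makes sense for a continuous function, and it survives uniform limits. The
    test functions are smooth on the whole space, which is all that the barriers
    below need. *)
Definition supersol (O : set V) (C D : R) (W : V -> R) : Prop :=
  forall x0, O x0 -> forall (psi L : V -> R),
    continuous psi -> continuous L -> (forall x, has_lap psi x (L x)) ->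
    (\forall x \near x0, W x0 - psi x0 <= W x - psi x) ->
    L x0 <= C * `|W x0| + D.

Lemma supersolS (O1 O2 : set V) C D W : O1 `<=` O2 ->
  supersol O2 C D W -> supersol O1 C D W.
Proof. by move=> sO s2 x0 /sO; exact: s2. Qed.

(** A classical parabolic inequality becomes a supersolution property in the
    limit of large time. A test function that touches W at x0 is made to touch
    strictly by subtracting a small multiple of |x - x0|^2, and the time is
    localised near T0 + 1 by a quadratic penalty of the size d of the remaining
    distance between w and W. The minimum over the resulting compact cylinder is
    interior, so that there the Laplacians compare and the time derivative is
    at most 8 d. *)
Lemma limit_supersol (O : set V) (w wt : V -> R -> R) (W : V -> R) (A C D : R) :
  open O -> 0 <= A -> 0 <= C ->
  (forall x (t : R), O x -> 0 < t ->
     {for (x, t), continuous (fun p : V * R => w p.1 p.2)}) ->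
  (forall x (t : R), O x -> 0 < t -> is_derive t 1 (w x) (wt x t)) ->
  (forall x (t : R), O x -> 0 < t -> exists2 l, has_lap (w^~ t) x l &
     l <= A * `|wt x t| + C * `|w x t| + D) ->
  (forall x, O x -> {for x, continuous W}) ->
  (forall d : R, 0 < d -> exists T, forall t, T <= t ->
     forall x, O x -> `|w x t - W x| <= d) ->
  supersol O C D W.
Proof.
move=> oO A0 C0 cw dw lapw cW unif x0 Ox0 psi L cpsi cL lpsi touch.
rewrite leNgt; apply/negP => H.
pose eta := L x0 - (C * `|W x0| + D).
have eta0 : 0 < eta by rewrite subr_gt0.
pose eps := eta / (8 * (N%:R + 1)).
have N1 : 0 < N%:R + 1 :> R by rewrite ltr_wpDl.
have eps0 : 0 < eps by rewrite divr_gt0// mulr_gt0.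
have epsN : 2 * N%:R * eps <= eta / 4.
  rewrite /eps mulrA ler_pdivrMr ?mulr_gt0//.
  have -> : eta / 4 * (8 * (N%:R + 1)) = 2 * eta * (N%:R + 1) by field.
  have -> : 2 * N%:R * eta = 2 * eta * N%:R by ring.
  by rewrite ler_wpM2l ?mulr_ge0 ?ltW// ltrDl.
have nO : \forall x \near x0, O x by exact: open_nbhs_nbhs.
have nL : \forall x \near x0, eta / 2 < L x - (C * `|W x| + D).
  have cLW : {for x0, continuous (fun x => L x - (C * `|W x| + D))}.
    apply: (cvgB (cL x0)); apply: cvgD; last exact: cvg_cst.
    by apply: cvgM; [exact: cvg_cst|apply: cvg_norm; exact: cW].
  apply: (cvgr_gt _ cLW); rewrite -/eta ltr_pdivrMr//; lra.
have [r r0 Hr] : exists2 r : R, 0 < r & forall x, dot (x - x0) (x - x0) <= r ->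
    [/\ O x, W x0 - psi x0 <= W x - psi x &
        eta / 2 < L x - (C * `|W x| + D)].
  have n1 : \forall x \near x0, O x /\ eta / 2 < L x - (C * `|W x| + D).
    exact: (nearS2 (fun x a b => conj a b) nO nL).
  by apply: near_dotP; apply: nearS2 n1 touch => x [].
have AC0 : 0 < 8 * A + C + 1 by lra.
(* small enough for an interior minimum, and for the errors to stay below eta *)
pose d := Num.min (eps * r / 4) (eta / (4 * (8 * A + C + 1))).
have d0 : 0 < d by rewrite lt_min !divr_gt0// mulr_gt0.
have d1 : 2 * d <= eps * r / 2.
  have : d <= eps * r / 4 by rewrite ge_min lexx.
  by lra.
have d2 : (8 * A + C) * d <= eta / 4.
  have : d <= eta / (4 * (8 * A + C + 1)) by rewrite ge_min lexx orbT.
  rewrite ler_pdivlMr ?mulr_gt0// => h.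
  rewrite ler_pdivlMr//; have := ltW d0; lra.
have [T HT] := unif d d0.
pose T0 := Num.max T 0 + 1.
have T0T : T <= T0 by rewrite /T0 (@le_trans _ _ (Num.max T 0)) ?le_max ?lexx ?lerDl.
have T0p : 0 < T0 by rewrite /T0 ltr_wpDl// le_max lexx orbT.
pose q x := dot (x - x0) (x - x0).
have q00 : q x0 = 0 by rewrite /q subrr dot0l.
pose B : set V := [set x | q x <= r].
pose K : set (V * R) := B `*` `[T0, T0 + 2].
pose Phi (p : V * R) := w p.1 p.2 - psi p.1 + eps * q p.1 + 4 * d * (p.2 - (T0 +
  1)) ^+ 2.
have cK : compact K.
  by apply: compact_setX; [exact: closed_ball_compact|exact: segment_compact].
have K0 : K (x0, T0 + 1).
  by split; rewrite /B/= ?q00 ?ltW// in_itv/=; lra.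
have cPhi : {within K, continuous Phi}.
  apply: continuous_in_subspaceT => -[x t]; rewrite inE => -[/= Bx].
  rewrite in_itv/= => /andP[t1 t2]; have [Ox _ _] := Hr x Bx.
  have tp : 0 < t by exact: lt_le_trans T0p t1.
  have c1 : (fun p : V * R => p.1) @ nbhs (x, t) --> x by exact: cvg_fst.
  have c2 : (fun p : V * R => p.2) @ nbhs (x, t) --> t by exact: cvg_snd.
  have k1 := @cvg_comp _ _ _ (fun p : V * R => p.1) psi _ _ _ c1 (cpsi x).
  have k2 := @cvg_comp _ _ _ (fun p : V * R => p.1) q _ _ _ c1
    (@dot_shift_continuous R N x0 x).
  have k3 : (p.2 - (T0 + 1)) @[p --> (x, t)] --> t - (T0 + 1).
    exact: (cvgB c2 (cvg_cst (T0 + 1))).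
  have k4 : (p.2 - (T0 + 1)) ^+ 2 @[p --> (x, t)] --> (t - (T0 + 1)) ^+ 2.
    exact: (@cvg_comp _ _ _ (fun p : V * R => p.2 - (T0 + 1)) (fun z : R => z ^+ 2)
      _ _ _ k3
      (@exprn_continuous R 2 _)).
  exact: (cvgD (cvgD (cvgB (cw x t Ox tp) k1) (cvgM (cvg_cst eps) k2))
    (cvgM (cvg_cst (4 * d)) k4)).
have [[x1 t1]] := compact_EVT_min (ex_intro _ _ K0) cK cPhi.
rewrite inE => -[/= Bx1]; rewrite in_itv/= => /andP[t1a t1b] minPhi.
have [Ox1 touch1 L1] := Hr x1 Bx1.
have {}minPhi x t : q x <= r -> T0 <= t <= T0 + 2 -> Phi (x1, t1) <= Phi (x, t).
  by move=> xr tt; apply: minPhi; rewrite inE; split.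
have t1p : 0 < t1 by exact: lt_le_trans T0p t1a.
have near0 : eps * q x1 + 4 * d * (t1 - (T0 + 1)) ^+ 2 <= 2 * d.
  have := minPhi x0 (T0 + 1); rewrite q00 (ltW r0) => /(_ isT ltac:(lra)).
  rewrite /Phi /= q00 subrr expr0n/= !mulr0 !addr0.
  have := HT (T0 + 1) ltac:(lra) x0 Ox0; have := HT t1 ltac:(lra) x1 Ox1.
  rewrite !ler_norml => /andP[a1 a2] /andP[b1 b2]; lra.
have q1 : q x1 < r.
  have h : 0 <= 4 * d * (t1 - (T0 + 1)) ^+ 2 by rewrite mulr_ge0 ?sqr_ge0 ?mulr_ge0
    ?ltW.
  rewrite -(ltr_pM2l eps0); have := mulr_gt0 eps0 r0; lra.
have s1 : (t1 - (T0 + 1)) ^+ 2 < 1.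
  have h : 0 <= eps * q x1 by rewrite mulr_ge0 ?dot_ge0 ?ltW.
  rewrite -(ltr_pM2l (mulr_gt0 (ltr0n _ 4) d0)); lra.
have s2 : - 1 < t1 - (T0 + 1) < 1.
  by rewrite -ltr_norml -(@expr_lt1 _ 2)// real_normK ?num_real.
have Dt (t : R) : 0 < t -> is_derive t 1 (fun t => w x1 t + 4 * d * (t - (T0 + 1))
  ^+ 2)
    (wt x1 t + 8 * d * (t - (T0 + 1))).
  move=> tp.
  have h1 := is_derive_funD (is_derive_fun_id t) (is_derive_funC (- (T0 + 1)) t 1).
  have := is_derive_funD (dw x1 t Ox1 tp) (is_derive_funZ (4 * d) (is_derive_funM
    h1 h1)).
  by congr (is_derive _ _ _ _); ring.
have wt1 : wt x1 t1 + 8 * d * (t1 - (T0 + 1)) = 0.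
  have [_ <-] := Dt t1 t1p.
  suff DD : is_derive t1 1 (fun t => w x1 t + 4 * d * (t - (T0 + 1)) ^+ 2) 0.
    by rewrite (@derive_val _ _ _ _ _ _ _ DD).
  apply: (@derive1_at_min R _ T0 (T0 + 2) t1).
  - lra.
  - by move=> t; rewrite in_itv/= => /andP[ta tb]; have [] := Dt t (lt_trans T0p ta).
  - by rewrite in_itv/=; lra.
  - move=> t; rewrite in_itv/= => /andP[ta tb].
    by have := minPhi x1 t Bx1 ltac:(lra); rewrite /Phi/=; lra.
have [l lapl lle] := lapw x1 t1 Ox1 t1p.
have lmin : 0 <= l - L x1 + eps * (2 * N%:R).
  apply: (has_lap_min (has_lapD (has_lapB lapl (lpsi x1)) (has_lapZ eps
    (has_lap_sqdist x0 x1)))).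
  apply: nearS (near_dot_lt q1) => x /ltW xr.
  by have := minPhi x t1 xr ltac:(lra); rewrite /Phi/= /q; lra.
have wtb : A * `|wt x1 t1| <= A * (8 * d).
  rewrite ler_wpM2l//; have -> : wt x1 t1 = - (8 * d * (t1 - (T0 + 1))) by lra.
  rewrite normrN normrM gtr0_norm ?mulr_gt0// ler_piMr ?mulr_ge0 ?ltW//.
  by rewrite ltr_norml.
have wb : C * `|w x1 t1| <= C * `|W x1| + C * d.
  rewrite -mulrDr ler_wpM2l//.
  have := HT t1 ltac:(lra) x1 Ox1; rewrite distrC => h.
  have := ler_normB (W x1) (W x1 - w x1 t1); rewrite opprB addrC subrK; lra.
lra.
Qed.

End Supersolutions.

(** * Comparison principles from explicit barriers *)

Section MaximumPrinciples.
Variables (R : realType) (N : nat).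
Notation V := 'rV[R]_N.
Implicit Types x y v : V.

Definition gauss (a : R) y x : R := expR (a * dot (x - y) (x - y)).

Definition lap_gauss (a : R) y x : R :=
  (4 * a ^+ 2 * dot (x - y) (x - y) + 2 * N%:R * a) * gauss a y x.

Lemma gauss_gt0 a y x : 0 < gauss a y x.
Proof. exact: expR_gt0. Qed.

Lemma has_lap_gauss a y x : has_lap (gauss a y) x (lap_gauss a y x).
Proof.
have d1 (k p : R) : is_derive p 1 (fun p => k * expR (a * p)) (a * (k * expR (a *
  p))).
  have := is_derive_funZ k (is_derive1_comp (is_derive_expR (a * p))
    (is_derive_funZ a (is_derive_fun_id p))).
  by congr (is_derive _ _ _ _); ring.
have d0 (p : R) : is_derive p 1 (fun p => expR (a * p)) (a * expR (a * p)).
  by have := d1 1 p; rewrite mul1r; under eq_fun do rewrite mul1r.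
have := @has_lap_radial R N (fun p => expR (a * p)) (fun p => a * expR (a * p)) _ y
  x _ (d1 a _).
rewrite /lap_gauss /gauss => h.
suff -> : (4 * a ^+ 2 * dot (x - y) (x - y) + 2 * N%:R * a) *
    expR (a * dot (x - y) (x - y)) =
  4 * dot (x - y) (x - y) * (a * (a * expR (a * dot (x - y) (x - y)))) +
      2 * N%:R * (a * expR (a * dot (x - y) (x - y))).
  by apply: h; exists 1 => //= p _; exact: d0.
by ring.
Qed.

Lemma gauss_continuous a y : continuous (gauss a y).
Proof.
move=> x.
have h : (a * dot (z - y) (z - y)) @[z --> x] --> a * dot (x - y) (x - y).
  exact: (cvgM (cvg_cst a) (@dot_shift_continuous R N y x)).
exact: (@cvg_comp _ _ _ (fun x => a * dot (x - y) (x - y)) expR _ _ _ h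
  (@continuous_expR R _)).
Qed.

Lemma lap_gauss_continuous a y : continuous (lap_gauss a y).
Proof.
move=> x.
exact: (cvgM (cvgD (cvgM (cvg_cst (4 * a ^+ 2)) (@dot_shift_continuous R N y x))
  (cvg_cst (2 * N%:R * a))) (@gauss_continuous a y x)).
Qed.

(** Strong maximum principle and Hopf lemma in one estimate. The barrier
    exp(-be |x - y|^2) - exp(-be r) has Laplacian above C times itself away from
    y once be is large; near y it is dominated by the positive value of W, and at
    the boundary it vanishes linearly. *)
Lemma supersol_hopf (W : V -> R) (C : R) y (r : R) : 0 <= C -> 0 < r ->
  (forall x, dot (x - y) (x - y) <= r -> {for x, continuous W}) ->
  (forall x, dot (x - y) (x - y) <= r -> 0 <= W x) ->
  supersol [set x | dot (x - y) (x - y) < r] C 0 W -> 0 < W y ->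
  exists2 k : R, 0 < k &
    forall x, dot (x - y) (x - y) <= r -> k * (r - dot (x - y) (x - y)) <= W x.
Proof.
move=> C0 r0 cW W0 sW Wy.
pose q x := dot (x - y) (x - y).
pose m := W y / 2.
have m0 : 0 < m by rewrite divr_gt0.
have [s s0 Hs] : exists2 s : R, 0 < s & forall x, q x <= s -> m < W x.
  apply: near_dotP; apply: (cvgr_gt _ (cW y _)).
    by rewrite subrr dot0l ltW.
  by rewrite /m ltr_pdivrMr// ltr_pMr// ltr1n.
pose be := (N%:R + C + 1) / s + 1.
have NC : 0 < N%:R + C + 1 by rewrite ltr_wpDl// addr_ge0.
have be1 : 1 <= be by rewrite lerDr divr_ge0// ltW.
have be0 : 0 < be by lra.
have bes : N%:R + C + 1 <= be * s by rewrite mulrDl divfK ?gt_eqF// mul1r lerDl ltW.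
pose e p := expR (- be * p).
pose b x := m * (gauss (- be) y x - e r).
pose L x := m * lap_gauss (- be) y x.
have cb : continuous b.
  by move=> x; exact: (cvgM (cvg_cst m) (cvgB (@gauss_continuous (- be) y x)
    (cvg_cst (e r)))).
have cL : continuous L.
  by move=> x; exact: (cvgM (cvg_cst m) (@lap_gauss_continuous (- be) y x)).
have lapb x : has_lap b x (L x).
  have := has_lapZ m (has_lapB (has_lap_gauss (- be) y x) (has_lap_cst (e r) x)).
  by rewrite subr0.
have Wb x : q x <= r -> b x <= W x.
  have cK := @closed_ball_compact R N y r.
  have K0 : [set x | q x <= r] !=set0 by exists y; rewrite /q /= subrr dot0l ltW.
  have cf : {within [set x | q x <= r], continuous (fun x => W x - b x)}.
    apply: continuous_in_subspaceT => z; rewrite inE /= => qz.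
    exact: (cvgB (cW z qz) (cb z)).
  have [x0] := compact_EVT_min K0 cK cf.
  rewrite inE /= => qx0 minx0 qx.
  rewrite -subr_ge0; apply: le_trans (minx0 x _); last by rewrite inE.
  rewrite leNgt; apply/negP => Hneg.
  have bm : b x0 <= m * gauss (- be) y x0.
    by rewrite ler_wpM2l ?(ltW m0)// lerBlDr lerDl expR_ge0.
  have [qs|sq] := leP (q x0) s.
    have : gauss (- be) y x0 <= 1.
      by rewrite /gauss -expR0 ler_expR mulNr oppr_le0 mulr_ge0 ?dot_ge0 ?ltW.
    move=> /(ler_wpM2l (ltW m0)); rewrite mulr1 => h; have := Hs _ qs.
    by lra.
  have [qr|rq] := ltP (q x0) r; last first.
    have qr : q x0 = r by apply/eqP; rewrite eq_le qx0 rq.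
    have b0 : b x0 = 0 by rewrite /b /gauss -/(q x0) qr subrr mulr0.
    by have := W0 x0 qx0; rewrite b0 in Hneg; lra.
  have := sW x0 qr b L cb cL lapb.
  have h3 : \forall x \near x0, W x0 - b x0 <= W x - b x.
    by apply: nearS (near_dot_lt qr) => z /ltW qz; apply: minx0; rewrite inE.
  move=> /(_ h3); rewrite addr0 ger0_norm ?W0// => H.
  have g0 := gauss_gt0 (- be) y x0.
  have : C * W x0 <= C * (m * gauss (- be) y x0) by rewrite ler_wpM2l//; lra.
  have key : C < 4 * (- be) ^+ 2 * q x0 + 2 * N%:R * - be.
    have h : be * (N%:R + C + 1) <= be ^+ 2 * q x0.
      apply: (@le_trans _ _ (be * (be * s))); first by rewrite ler_wpM2l// ltW.
      by rewrite mulrA -expr2 ler_wpM2l ?sqr_ge0// ltW.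
    have h' : C + 1 <= be * (C + 1) by rewrite ler_peMl// addr_ge0.
    have h'' : 0 <= be * N%:R by rewrite mulr_ge0// ltW.
    have h4 : 0 <= be * C by rewrite mulr_ge0// ltW.
    rewrite sqrrN; lra.
  move: H; rewrite /L /lap_gauss -/(q x0) => H.
  have : 0 < m * gauss (- be) y x0 by rewrite mulr_gt0.
  move: key; rewrite -subr_gt0 => /mulr_gt0/[apply].
  by lra.
pose k := m * (be * e r).
exists k; first by rewrite !mulr_gt0// expR_gt0.
move=> x qx; apply: le_trans (Wb x qx).
rewrite /k /b -mulrA ler_wpM2l ?(ltW m0)//.
have -> : gauss (- be) y x = e r * expR (be * (r - q x)).
  by rewrite /gauss /e -expRD -/(q x); congr expR; ring.
rewrite -/(q x) -[X in _ <= _ - X]mulr1 -mulrBr mulrAC mulrC ler_wpM2l ?expR_ge0//.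
by have := expR_ge1Dx (be * (r - q x)); lra.
Qed.

(** A positive strict supersolution g forces W to be nonnegative: at a negative
    minimum of W / g, the multiple of g by this minimum touches W from below. It
    is enough that g be strict where W may be negative. *)
Lemma supersol_narrow (K O : set V) (W g Lg : V -> R) (C : R) : compact K ->
  (forall x, K x -> {for x, continuous W}) -> supersol O C 0 W ->
  continuous g -> continuous Lg -> (forall x, K x -> 0 < g x) ->
  (forall x, has_lap g x (Lg x)) ->
  (forall x, K x -> W x < 0 -> [/\ O x, \forall z \near x, K z & Lg x + C * g x <
    0]) ->
  forall x, K x -> 0 <= W x.
Proof.
move=> cK cW sW cg cLg g0 lapg H x Kx; rewrite leNgt; apply/negP => Wx.
have cf : {within K, continuous (fun x => W x / g x)}.
  apply: continuous_in_subspaceT => z; rewrite inE /= => Kz.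
  exact: (cvgM (cW z Kz) (cvgV (lt0r_neq0 (g0 z Kz)) (cg z))).
have [x0] := compact_EVT_min (ex_intro _ _ Kx) cK cf.
rewrite inE /= => Kx0 minx0.
pose m := W x0 / g x0.
have m0 : m < 0.
  apply: le_lt_trans (minx0 x _) _; first by rewrite inE.
  by rewrite pmulr_llt0// invr_gt0 g0.
have gx0 := g0 x0 Kx0.
have Wx0 : W x0 = m * g x0 by rewrite /m divfK// gt_eqF.
have Wx0' : W x0 < 0 by rewrite Wx0 nmulr_rlt0.
have [Ox0 nK Hx0] := H x0 Kx0 Wx0'.
have cmg : continuous (fun x => m * g x).
  by move=> z; exact: (cvgM (cvg_cst m) (cg z)).
have cmL : continuous (fun x => m * Lg x).
  by move=> z; exact: (cvgM (cvg_cst m) (cLg z)).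
have := sW x0 Ox0 _ _ cmg cmL (fun x => has_lapZ m (lapg x)).
have h4 : \forall x \near x0, W x0 - m * g x0 <= W x - m * g x.
  apply: nearS nK => z Kz; rewrite Wx0 subrr subr_ge0 -ler_pdivlMr ?g0//.
  by apply: minx0; rewrite inE.
move=> /(_ h4); rewrite addr0 ltr0_norm// Wx0.
apply/negP; rewrite -ltNge -subr_lt0.
have -> : C * - (m * g x0) - m * Lg x0 = (- m) * (Lg x0 + C * g x0) by ring.
by rewrite pmulr_rlt0// oppr_gt0.
Qed.

End MaximumPrinciples.

(** * Moving spheres *)

Section MovingSpheres.
Variables (R : realType) (N : nat).
Notation V := 'rV[R]_N.
Implicit Types x y v c e : V.

(** The part of the ball outside the fixed sphere of the inversion; the inversion
    maps it to the other side, closer to the origin. *)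
Definition cap c : set V :=
  [set x | dot x x < 1 /\ 1 < dot x x + 2 * dot c x].
Definition ccap c : set V :=
  [set x | dot x x <= 1 /\ 1 <= dot x x + 2 * dot c x].

Lemma cap_ccap c : cap c `<=` ccap c.
Proof. by move=> x [a b]; split; exact: ltW. Qed.

Lemma cap_open c : open (cap c).
Proof.
apply: openI; first by apply: open_comp (@open_lt R 1) => x _; exact:
  dotxx_continuous.
apply: (@open_comp _ _ (fun x => dot x x + 2 * dot c x)) (@open_gt R 1) => x _.
exact: (cvgD (@dotxx_continuous R N x) (cvgM (cvg_cst (2 : R)) (@dotl_continuous R
  N c x))).
Qed.

Lemma ccap_closed c : closed (ccap c).
Proof.
apply: closedI; first by apply: closed_comp (@closed_le R 1) => x _; exact:
  dotxx_continuous.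
apply: (@closed_comp _ _ (fun x => dot x x + 2 * dot c x)) (@closed_ge R 1) => x _.
exact: (cvgD (@dotxx_continuous R N x) (cvgM (cvg_cst (2 : R)) (@dotl_continuous R
  N c x))).
Qed.

Lemma ccap_compact c : compact (ccap c).
Proof. by apply: (@closed_bounded_compact _ _ _ 1 (@ccap_closed c)) => x []. Qed.

Lemma ccap_sqd c x : ccap c x -> kap c <= sqd c x.
Proof. by move=> [_ h]; rewrite sqdE /kap; lra. Qed.

Lemma ccap_sqd_gt0 c x : ccap c x -> 0 < sqd c x.
Proof. by move=> /ccap_sqd; apply: lt_le_trans; exact: kap_gt0. Qed.

Lemma ccap_mu c x : ccap c x -> 0 < mu c x <= 1.
Proof.
move=> h; rewrite mu_gt0 ?ccap_sqd_gt0//= /mu ler_pdivrMr ?ccap_sqd_gt0//.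
by rewrite mul1r ccap_sqd.
Qed.

(** The factor 1 + |x|^2, up to a constant the inverse of the conformal factor of
    the stereographic projection, is multiplied by mu: this is what ties the
    inversions to the weights in the monotonicity hypothesis on f. *)
Lemma invc_dot c x : 0 < sqd c x ->
  1 + dot (invc c x) (invc c x) = mu c x * (1 + dot x x).
Proof.
move=> S0; have S0' := lt0r_neq0 S0.
have E : mu c x * sqd c x = kap c by rewrite /mu divfK.
have -> : dot (invc c x) (invc c x) = mu c x * (mu c x * sqd c x) -
    2 * mu c x * (dot c x + dot c c) + dot c c.
  by rewrite /invc sqdE !dotE (dotC x c); ring.
rewrite E; apply: (@eq_trans _ _ (kap c + mu c x * (kap c - 2 * dot c x - 2 * dot c
  c))).
  by rewrite /kap; ring.
by rewrite -{1}E sqdE /kap; ring.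
Qed.

Lemma invc_arc c x : 0 < sqd c x -> dot x x + 2 * dot c x = 1 ->
  mu c x = 1 /\ invc c x = x.
Proof.
move=> S0 h; have m1 : mu c x = 1.
  by rewrite /mu (_ : sqd c x = kap c) ?divff ?gt_eqF ?kap_gt0// sqdE /kap; lra.
by rewrite /invc m1 scale1r addrK.
Qed.

Variables (phi : V -> R) (C : R).
Hypotheses (C0 : 0 <= C) (cphi : continuous phi)
  (phi_out : forall x, 1 <= dot x x -> phi x = 0)
  (phi_in : forall x, dot x x < 1 -> 0 < phi x).

Definition Wdiff c x := kelvin c phi x - phi x.

Hypothesis sW : forall c, supersol (cap c) C 0 (Wdiff c).

Lemma phi_ge0 x : 0 <= phi x.
Proof. by have [/phi_out->|/phi_in/ltW] := leP 1 (dot x x). Qed.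

Lemma cvg_Wdiff (T : Type) (F : set_system T) {FF : Filter F}
    (ct xt : T -> V) c x :
  ct t @[t --> F] --> c -> xt t @[t --> F] --> x -> 0 < sqd c x ->
  Wdiff (ct t) (xt t) @[t --> F] --> Wdiff c x.
Proof.
move=> hc hx S0.
have h : kelvin (ct t) phi (xt t) @[t --> F] --> kelvin c phi x.
  by apply: (cvg_kelvin hc hx S0); exact: cphi.
have h' : phi (xt t) @[t --> F] --> phi x.
  have hphi : phi y @[y --> x] --> phi x by exact: cphi.
  exact: (@cvg_comp _ _ _ xt phi _ _ _ hx hphi).
have h2 : (kelvin (ct t) phi (xt t) - phi (xt t)) @[t --> F] -->
    kelvin c phi x - phi x.
  exact: (cvgB h h').
exact: h2.
Qed.

Lemma Wdiff_continuous c x : 0 < sqd c x -> {for x, continuous (Wdiff c)}.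
Proof. by move=> S0; exact: (cvg_Wdiff (cvg_cst c) (@cvg_id _ (nbhs x)) S0). Qed.

Lemma Wdiff_arc c x : 0 < sqd c x -> dot x x + 2 * dot c x = 1 -> Wdiff c x = 0.
Proof.
by move=> S0 /(invc_arc S0)[m1 i1]; rewrite /Wdiff /kelvin m1 i1 powR1 mul1r subrr.
Qed.

Lemma Wdiff_sphere_ge0 c x : dot x x = 1 -> 0 <= Wdiff c x.
Proof.
move=> x1; rewrite /Wdiff (phi_out _) ?x1// subr0 mulr_ge0// ?phi_ge0//.
exact: powR_ge0.
Qed.

(** On the outer boundary phi vanishes, while the inversion sends the point into
    the open ball. *)
Lemma Wdiff_sphere_gt0 c x : dot x x = 1 -> 0 < dot c x -> 0 < Wdiff c x.
Proof.
move=> x1 cx; have S0 : kap c < sqd c x by rewrite sqdE /kap; lra.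
have S1 : 0 < sqd c x := lt_trans (kap_gt0 c) S0.
rewrite /Wdiff (phi_out _) ?x1// subr0 mulr_gt0 ?powR_gt0 ?mu_gt0//.
apply: phi_in; have := invc_dot S1; rewrite x1 => E.
have : mu c x < 1 by rewrite /mu ltr_pdivrMr// mul1r.
by lra.
Qed.

(** The exponent of the barriers depends on N and C only, and so does the width
    eta of the boundary layer in which they work: it is the same for all c. *)
Definition be : R := N%:R + 4 * C + 1.
Definition eta : R := (2 * be)^-1.

Lemma be_ge1 : 1 <= be. Proof. by rewrite lerDr addr_ge0// mulr_ge0. Qed.
Lemma be_geN : N%:R <= be. Proof. by rewrite /be -addrA lerDl addr_ge0// mulr_ge0.
  Qed.
Lemma be_geC : 4 * C < be.
Proof. by rewrite /be; have := ler0n R N; lra. Qed.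
Lemma eta_gt0 : 0 < eta. Proof. by rewrite invr_gt0 mulr_gt0// (lt_le_trans ltr01
  be_ge1). Qed.
Lemma be_eta : be * eta = 2^-1.
Proof. by rewrite /eta invfM mulrCA divff ?mulr1// gt_eqF// (lt_le_trans ltr01
  be_ge1). Qed.

Definition kelvin_above c := forall x, ccap c x -> 0 <= Wdiff c x.

Lemma expR_half (t : R) : be * t <= 2^-1 -> 2^-1 <= expR (- be * t).
Proof. by move=> h; have := expR_ge1Dx (- be * t); rewrite mulNr; lra. Qed.

(** It suffices to check the points of the cap at distance eta from both of its
    boundary spheres, measured by |x|^2 and |x + c|^2. In the remaining layer
    the barrier 4 - E1 - E2 is a strict supersolution, where E1 and E2 are
    exponentials that are close to 1 near the outer and the inner sphere. *)
Lemma kelvin_above_of_core c :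
  (forall x, ccap c x -> eta <= 1 - dot x x -> eta <= dot x x + 2 * dot c x - 1 ->
     0 <= Wdiff c x) -> kelvin_above c.
Proof.
move=> core.
have be0 : 0 < be := lt_le_trans ltr01 be_ge1.
pose E1 x := expR (- be) * gauss be 0 x.
pose E2 x := expR (be * kap c) * gauss (- be) (- c) x.
pose g x := 4 - (E1 x + E2 x).
pose Lg x := - (expR (- be) * lap_gauss be 0 x + expR (be * kap c) * lap_gauss (-
  be) (- c) x).
have E1E x : E1 x = expR (- be * (1 - dot x x)).
  by rewrite /E1 /gauss -expRD subr0; congr expR; ring.
have E2E x : E2 x = expR (- be * (sqd c x - kap c)).
  by rewrite /E2 /gauss -expRD -/(sqd c x); congr expR; ring.
have E1b x : ccap c x -> 0 < E1 x <= 1.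
  move=> [x1 _]; rewrite E1E expR_gt0/= -[leRHS]expR0 ler_expR mulNr oppr_le0.
  by rewrite mulr_ge0 ?(ltW be0)// subr_ge0.
have E2b x : ccap c x -> 0 < E2 x <= 1.
  move=> /ccap_sqd h; rewrite E2E expR_gt0/= -[leRHS]expR0 ler_expR mulNr oppr_le0.
  by rewrite mulr_ge0 ?(ltW be0)// subr_ge0.
apply: (@supersol_narrow R N (ccap c) (cap c) (Wdiff c) g Lg C).
- exact: ccap_compact.
- by move=> x /ccap_sqd_gt0; exact: Wdiff_continuous.
- exact: sW.
- move=> x; exact: (cvgB (cvg_cst (4 : R)) (cvgD
    (cvgM (cvg_cst (expR (- be))) (@gauss_continuous R N be 0 x))
    (cvgM (cvg_cst (expR (be * kap c))) (@gauss_continuous R N (- be) (- c) x)))).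
- move=> x; exact: (cvgN (cvgD
    (cvgM (cvg_cst (expR (- be))) (@lap_gauss_continuous R N be 0 x))
    (cvgM (cvg_cst (expR (be * kap c))) (@lap_gauss_continuous R N (- be) (- c) x)))).
- by move=> x Kx; have := E1b x Kx; have := E2b x Kx; rewrite /g; lra.
- move=> x; rewrite /Lg -[X in has_lap _ _ X]add0r; apply: has_lapB.
    exact: has_lap_cst.
  by apply: has_lapD; apply: has_lapZ; exact: has_lap_gauss.
move=> x Kx Wx; have [x1 x2] := Kx.
have capx : cap c x.
  split; rewrite lt_neqAle ?x1 ?x2 andbT.
    by apply/eqP => /(@Wdiff_sphere_ge0 c); rewrite leNgt Wx.
  by apply/eqP => /esym/(Wdiff_arc (ccap_sqd_gt0 Kx)) W0; rewrite W0 ltxx in Wx.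
split=> //.
  have : \forall z \near x, cap c z by apply: open_nbhs_nbhs; split => //; exact:
    cap_open.
  by apply: nearS => z; exact: cap_ccap.
have /andP[E1p E11] := E1b x Kx; have /andP[E2p E21] := E2b x Kx.
have LgE : Lg x = - ((4 * be ^+ 2 * dot x x + 2 * N%:R * be) * E1 x +
    (4 * be ^+ 2 * sqd c x - 2 * N%:R * be) * E2 x).
  by rewrite /Lg /lap_gauss /E1 /E2 !subr0 -/(sqd c x); ring.
have NB : N%:R * be <= be ^+ 2 by rewrite expr2 ler_wpM2r ?be_geN// ltW.
have b2 : 4 * C < be ^+ 2.
  by apply: lt_le_trans be_geC _; rewrite expr2 ler_peMl ?be_ge1// ltW.
have S1 : 1 <= sqd c x := le_trans (kap_ge1 c) (ccap_sqd Kx).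
have T1 : 0 <= (4 * be ^+ 2 * dot x x + 2 * N%:R * be) * E1 x.
  by rewrite mulr_ge0 ?(ltW E1p)// addr_ge0 ?mulr_ge0 ?dot_ge0 ?sqr_ge0// ltW.
have bS : be ^+ 2 <= be ^+ 2 * sqd c x by rewrite ler_peMr ?sqr_ge0.
have T2 : 2 * be ^+ 2 * E2 x <= (4 * be ^+ 2 * sqd c x - 2 * N%:R * be) * E2 x.
  by rewrite ler_pM2r//; lra.
have T20 : 0 <= 2 * be ^+ 2 * E2 x by rewrite mulr_ge0 ?(ltW E2p)// mulr_ge0//
  sqr_ge0.
have Cg : C * g x <= 4 * C by rewrite /g [4 * C]mulrC ler_wpM2l//; lra.
have [h1|h1] := leP eta (1 - dot x x); last first.
  have E1h : 2^-1 <= E1 x.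
    by rewrite E1E; apply: expR_half; rewrite -be_eta ler_wpM2l ?(ltW be0)// ltW.
  have e1 : eta <= 2^-1.
    by rewrite -be_eta ler_peMl ?be_ge1// ltW// eta_gt0.
  have : be ^+ 2 <= (4 * be ^+ 2 * dot x x + 2 * N%:R * be) * E1 x.
    have p1 : 0 <= N%:R * be by rewrite mulr_ge0// ltW.
    have p2 : be ^+ 2 * 2^-1 <= be ^+ 2 * dot x x by rewrite ler_wpM2l ?sqr_ge0//;
      lra.
    have p3 : 2 * be ^+ 2 <= 4 * be ^+ 2 * dot x x + 2 * N%:R * be by lra.
    have p4 : 2 * be ^+ 2 * 2^-1 <= 2 * be ^+ 2 * E1 x.
      by rewrite ler_wpM2l// mulr_ge0// sqr_ge0.
    have p5 := ler_wpM2r (ltW E1p) p3.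
    lra.
  by rewrite LgE; lra.
have [h2|h2] := leP eta (dot x x + 2 * dot c x - 1).
  by have := core x Kx h1 h2; rewrite leNgt Wx.
have E2h : 2^-1 <= E2 x.
  rewrite E2E; apply: expR_half; rewrite -be_eta ler_wpM2l ?(ltW be0)//.
  by rewrite sqdE /kap; lra.
have : be ^+ 2 <= 2 * be ^+ 2 * E2 x.
  have : be ^+ 2 * 2^-1 <= be ^+ 2 * E2 x by rewrite ler_wpM2l ?sqr_ge0.
  by lra.
by rewrite LgE; lra.
Qed.

Variable e : V.
Hypothesis e1 : dot e e = 1.

Lemma dot_e_bound x : `|2 * dot e x| <= 1 + dot x x.
Proof.
have := dot_ge0 (x + e); have := dot_ge0 (x - e).
by rewrite !dotE (dotC x e) e1 ler_norml; lra.
Qed.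

(** For small s the cap lies inside the boundary layer. *)
Lemma kelvin_above_small (s : R) : 0 < s -> 2 * s < eta -> kelvin_above (s *: e).
Proof.
move=> s0 se; apply: kelvin_above_of_core => x [x1 x2] h _; exfalso.
have := dot_e_bound x; rewrite ler_norml => /andP[_].
rewrite dotZl in x2.
move: x2; have -> : 2 * (s * dot e x) = s * (2 * dot e x) by ring.
move=> x2 /(ler_wpM2l (ltW s0)) h3.
have : s * (1 + dot x x) <= s * 2 by rewrite ler_wpM2l ?ltW//; lra.
lra.
Qed.

Lemma cap_dot_gt0 (s : R) x : 0 < s -> ccap (s *: e) x -> dot x x < 1 -> 0 < dot e x.
Proof.
by move=> s0 [_]; rewrite dotZl => h1 h2; rewrite -(pmulr_rgt0 _ s0); lra.
Qed.

(** Otherwise push a zero of the difference in the direction e. This stays in the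
    cap until it meets the outer sphere, where the difference is positive; at
    the last zero, a small ball that contains it and whose centre lies a little
    further contradicts the Hopf estimate. *)
Lemma kelvin_above_strict (s : R) : 0 < s -> kelvin_above (s *: e) ->
  forall x, cap (s *: e) x -> 0 < Wdiff (s *: e) x.
Proof.
move=> s0 gs x capx; set c := s *: e.
rewrite lt_neqAle (gs x (cap_ccap capx)) andbT; apply/eqP => /esym W0.
have ex : 0 < dot e x by apply: cap_dot_gt0 s0 (cap_ccap capx) _; case: capx.
pose z (t : R) := t *: e + x.
have zc (t : R) : z u @[u --> t] --> z t.
  apply: cvgD; last exact: cvg_cst.
  by apply: cvgZr_tmp; exact: cvg_id.
have zz t : dot (z t) (z t) = t ^+ 2 + 2 * t * dot e x + dot x x.
  by rewrite /z !dotE (dotC x e) e1; ring.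
have ez t : dot e (z t) = t + dot e x by rewrite /z !dotE e1; ring.
have zcap t : 0 <= t -> 1 < dot (z t) (z t) + 2 * dot c (z t).
  move=> t0; have [_] := capx; rewrite zz /c !dotZl ez.
  have : 0 <= t ^+ 2 by exact: sqr_ge0.
  have : 0 <= t * dot e x by rewrite mulr_ge0// ltW.
  have : 0 <= s * t by rewrite mulr_ge0// ltW.
  by lra.
have zS t : 0 <= t -> 0 < sqd c (z t).
  move=> /zcap h; rewrite sqdE; have := dot_ge0 c; lra.
pose Z : set R := [set t | 0 <= t /\ (dot (z t) (z t) <= 1 /\ Wdiff c (z t) <= 0)].
have Z0 : Z 0.
  split=> //; rewrite /z scale0r add0r W0; split => //.
  by have [/ltW] := capx.
have supZ : has_sup Z.
  split; first by exists 0.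
  exists 1 => t [t0 [zt _]]; rewrite leNgt; apply/negP => t1.
  have := mulr_gt0 ex (lt_trans ltr01 t1).
  have : 1 < t ^+ 2 by rewrite expr_gt1// ltW.
  by have := dot_ge0 x; rewrite zz in zt; lra.
pose t0 := sup Z.
have t00 : 0 <= t0 by apply: sup_upper_bound.
have cl (P : R -> Prop) : (\forall t \near t0, P t) -> exists2 t, Z t & P t.
  move=> [d /= d0 Hd]; have [t Zt tt] := sup_adherent d0 supZ.
  exists t => //; apply: Hd; rewrite /ball_/=.
  rewrite ger0_norm ?subr_ge0; last exact: sup_upper_bound.
  by rewrite ltrBlDr -ltrBlDl.
have zt1 : dot (z t0) (z t0) <= 1.
  rewrite leNgt; apply/negP => h.
  have n : \forall t \near t0, 1 < dot (z t) (z t).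
    exact: (cvgr_gt _ (cvg_dot (zc t0) (zc t0)) _ h).
  by have [t [_ [+ _]]] := cl _ n; rewrite leNgt => /negP.
have Wt0 : Wdiff c (z t0) <= 0.
  rewrite leNgt; apply/negP => h.
  have cWz : Wdiff c (z t) @[t --> t0] --> Wdiff c (z t0).
    exact: (@cvg_comp _ _ _ z (Wdiff c) _ _ _ (zc t0) (Wdiff_continuous (zS t0 t00))).
  have n : \forall t \near t0, 0 < Wdiff c (z t) by exact: (cvgr_gt _ cWz _ h).
  by have [t [_ [_ +]]] := cl _ n; rewrite leNgt => /negP.
have zt1' : dot (z t0) (z t0) < 1.
  rewrite lt_neqAle zt1 andbT; apply/eqP => zE.
  have : 0 < Wdiff c (z t0).
    by apply: Wdiff_sphere_gt0 => //; rewrite /c dotZl ez mulr_gt0//; lra.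
  by rewrite ltNge Wt0.
have capz : cap c (z t0) by split => //; exact: zcap.
have [r r0 Hr] := near_dotP (open_nbhs_nbhs (conj (@cap_open c) capz)).
(* the ball of squared radius 9/4 d^2 around y contains z t0 in its interior,
   and 7 d <= r keeps it inside the cap *)
pose d := Num.min 1 (r / 7).
have d0 : 0 < d by rewrite lt_min ltr01 divr_gt0.
have d1 : d <= 1 by rewrite ge_min lexx.
have d7 : 7 * d <= r by have : d <= r / 7 by [rewrite ge_min lexx orbT]; lra.
have dd : d ^+ 2 <= d by rewrite expr2 ler_piMr// ltW.
have dd0 : 0 < d ^+ 2 by rewrite exprn_gt0.
pose y := z (t0 + d).
have dist p : dot (p - y) (p - y) <= 9 / 4 * d ^+ 2 -> dot (p - z t0) (p - z t0) <= r.
  have -> : y = z t0 + d *: e by rewrite /y /z scalerDl addrAC.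
  have -> : p - (z t0 + d *: e) = (p - z t0) - d *: e by rewrite opprD addrA.
  move: (p - z t0) => q.
  have := dot_ge0 (q - (2 * d) *: e).
  by rewrite !dotE e1 (dotC q e); lra.
have Hb p : dot (p - y) (p - y) <= 9 / 4 * d ^+ 2 -> cap c p by move=> /dist /Hr.
have Wy : 0 < Wdiff c y.
  rewrite ltNge; apply/negP => Wy.
  have : Z (t0 + d).
    split; first by rewrite addr_ge0// ltW.
    split => //; have [] := Hb y; last by move=> /ltW.
    by rewrite subrr dot0l mulr_ge0 ?divr_ge0// ltW.
  by move=> /(sup_upper_bound supZ); rewrite -/t0; lra.
have r9 : 0 < 9 / 4 * d ^+ 2 by rewrite mulr_gt0 ?divr_gt0.
have [k k0 Hk] := supersol_hopf C0 r9
  (fun p hp => Wdiff_continuous (ccap_sqd_gt0 (cap_ccap (Hb p hp))))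
  (fun p hp => gs p (cap_ccap (Hb p hp)))
  (supersolS (fun p hp => Hb p (ltW hp)) (@sW c)) Wy.
have yz : dot (z t0 - y) (z t0 - y) = d ^+ 2.
  have -> : z t0 - y = - d *: e by rewrite /y /z opprD addrACA subrr addr0
    -scalerBl; congr (_ *: _); ring.
  by rewrite !dotE e1; ring.
have := Hk (z t0); rewrite yz => /(_ ltac:(lra)).
have : 0 < k * (9 / 4 * d ^+ 2 - d ^+ 2) by rewrite mulr_gt0//; lra.
by lra.
Qed.

(** The core of the cap is compact and the difference is positive there, so it
    stays positive for nearby s; [kelvin_above_of_core] takes care of the layer. *)
Lemma kelvin_above_open (s : R) : 0 < s -> kelvin_above (s *: e) ->
  \forall s' \near s, kelvin_above (s' *: e).
Proof.
move=> s0 gs.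
have eta0 := eta_gt0.
pose K : set V := [set x | dot x x <= 1 - eta /\ 1 + eta / 2 <= dot x x + 2 * dot
  (s *: e) x].
have clK : closed K.
  apply: closedI; first by apply: closed_comp (@closed_le R (1 - eta)) => x _;
    exact: dotxx_continuous.
  apply: (@closed_comp _ _ (fun x => dot x x + 2 * dot (s *: e) x)) (@closed_ge R
    (1 + eta / 2)) => x _.
  exact: (cvgD (@dotxx_continuous R N x) (cvgM (cvg_cst (2 : R)) (@dotl_continuous
    R N (s *: e) x))).
have cK : compact K.
  by apply: (@closed_bounded_compact _ _ _ (1 - eta) clK) => x [].
have Kcap x : K x -> cap (s *: e) x by move=> [a b]; split; lra.
have nK : \forall s' \near s, K `<=` (fun x => 0 < Wdiff (s' *: e) x).
  apply: ((compact_near_coveringP K).1 cK _ (nbhs s) (fun s' x => 0 < Wdiff (s' *: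
    e) x) _) => x Kx.
  have S0 := ccap_sqd_gt0 (cap_ccap (Kcap x Kx)).
  have cc : (p.2 *: e) @[p --> (x, s)] --> s *: e.
    exact: (cvgZ cvg_snd (cvg_cst e)).
  have cx : p.1 @[p --> (x, s)] --> x by exact: cvg_fst.
  exact: (cvgr_gt _ (cvg_Wdiff cc cx S0) _ (kelvin_above_strict s0 gs (Kcap x Kx))).
have ns : \forall s' \near s, `|s - s'| < eta / 8.
  by apply: (@cvgr_dist_lt _ _ _ (nbhs s) _ id s) => //; rewrite divr_gt0.
apply: filterS2 nK ns => s' HK ss; apply: kelvin_above_of_core => x [x1 x2] h1 h2.
apply/ltW/HK; split; first lra.
have hx := dot_e_bound x.
have : `|(s - s') * (2 * dot e x)| <= eta / 8 * 2.
  by rewrite normrM ler_pM// ?ltW//; lra.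
rewrite ler_norml => /andP[h3 h4]; move: h2; rewrite !dotZl; lra.
Qed.

(** At the infimum of the bad parameters the inequality still holds by
    continuity, and then it extends beyond by [kelvin_above_open]. *)
Lemma kelvin_above_all (s : R) : 0 < s -> kelvin_above (s *: e).
Proof.
move=> s0; apply: contrapT => bs.
pose B : set R := [set t | 0 < t /\ ~ kelvin_above (t *: e)].
have Blb t : B t -> eta / 2 <= t.
  move=> [t0 bt]; rewrite leNgt; apply/negP => h; apply: bt; apply:
    kelvin_above_small => //; lra.
have iB : has_inf B by split; [exists s|exists (eta / 2)].
pose t := inf B.
have tp : 0 < t.
  apply: (@lt_le_trans _ _ (eta / 2)); first by rewrite divr_gt0// eta_gt0.
  by apply: lb_le_inf => //; case: iB.
have below u : 0 < u -> u < t -> kelvin_above (u *: e).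
  move=> u0 ut; apply: contrapT => bu; have : t <= u by apply: inf_lbound => //;
    case: iB.
  by rewrite leNgt ut.
have gt : kelvin_above (t *: e).
  move=> x Kx; have [x1 x2] := Kx.
  have S0 := ccap_sqd_gt0 Kx.
  have [xs|xs] := eqVneq (dot x x) 1; first exact: Wdiff_sphere_ge0.
  have [xa|xa] := eqVneq (dot x x + 2 * dot (t *: e) x) 1.
    by rewrite Wdiff_arc.
  have x1' : dot x x < 1 by rewrite lt_neqAle xs.
  have x2' : 1 < dot x x + 2 * dot (t *: e) x by rewrite lt_neqAle eq_sym xa.
  rewrite leNgt; apply/negP => Wx.
  have cc : (u *: e) @[u --> t] --> t *: e.
    by apply: cvgZr_tmp; exact: cvg_id.
  have n1 : \forall u \near t, Wdiff (u *: e) x < 0.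
    exact: (cvgr_lt _ (cvg_Wdiff cc (cvg_cst x) S0) _ Wx).
  have n2 : \forall u \near t, 1 < dot x x + 2 * dot (u *: e) x.
    exact: (cvgr_gt _ (cvgD (cvg_cst (dot x x)) (cvgM (cvg_cst (2 : R)) (cvg_dot cc
      (cvg_cst x)))) _ x2').
  have n3 : \forall u \near t, 0 < u by exact: (cvgr_gt _ (@cvg_id _ (nbhs t))).
  have n23 : \forall u \near t, 1 < dot x x + 2 * dot (u *: e) x /\ 0 < u.
    by apply: filterS2 n2 n3.
  have [d /= d0 Hd] : \forall u \near t, Wdiff (u *: e) x < 0 /\
      (1 < dot x x + 2 * dot (u *: e) x /\ 0 < u).
    by apply: filterS2 n1 n23.
  have [|a [b c]] := Hd (t - d / 2).
    by rewrite /ball_/= opprB addrC subrK ger0_norm ?divr_ge0 ?ltW// ltr_pdivrMr//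
      ltr_pMr// ltr1n.
  have : 0 <= Wdiff ((t - d / 2) *: e) x.
    by apply: below => //; [rewrite ltrBlDr ltrDl divr_gt0|split => //; exact: ltW].
  by rewrite leNgt a.
have [d /= d0 Hd] := kelvin_above_open tp gt.
have [u Bu ut] := inf_adherent d0 iB.
have tu : t <= u by apply: inf_lbound => //; case: iB.
have [_] := Bu; apply; apply: Hd; rewrite /ball_/= ler0_norm ?subr_le0//.
by rewrite opprB ltrBlDl.
Qed.

(** As s tends to infinity the inversions of centre - s e tend to the reflection
    in the hyperplane orthogonal to e, and their conformal factors to 1. *)
Lemma reflection_le x : dot x x < 1 -> 0 < dot e x ->
  phi x <= phi (x - (2 * dot e x) *: e).
Proof.
move=> x1 ex.
(* conformal factor and image of x in terms of t = 1/s, regular at t = 0 *)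
pose Den (t : R) := t * t * dot x x + 2 * t * dot e x + 1.
pose M (t : R) := (t * t + 1) / Den t.
pose Y (t : R) := M t *: x + ((t * (1 - dot x x) - 2 * dot e x) / Den t) *: e.
pose b : R := (N%:R - 2) / 2.
have Den0 : Den 0 = 1 by rewrite /Den !(mul0r, mulr0) !add0r.
have M0 : M 0 = 1 by rewrite /M Den0 mul0r add0r divr1.
have Y0 : Y 0 = x - (2 * dot e x) *: e.
  by rewrite /Y M0 Den0 mul0r sub0r divr1 scale1r scaleNr.
have cid : (t : R) @[t --> (0 : R)] --> (0 : R) by exact: cvg_id.
have cDen : Den t @[t --> (0 : R)] --> Den 0.
  exact: (cvgD (cvgD (cvgM (cvgM cid cid) (cvg_cst (dot x x)))
    (cvgM (cvgM (cvg_cst (2 : R)) cid) (cvg_cst (dot e x)))) (cvg_cst (1 : R))).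
have DenV : Den 0 != 0 by rewrite Den0 oner_neq0.
have cM : M t @[t --> (0 : R)] --> M 0.
  exact: (cvgM (cvgD (cvgM cid cid) (cvg_cst (1 : R))) (cvgV DenV cDen)).
have cY : Y t @[t --> (0 : R)] --> Y 0.
  have c1 : (M t *: x) @[t --> (0 : R)] --> M 0 *: x by exact: (cvgZ cM (cvg_cst x)).
  have c2 : ((t * (1 - dot x x) - 2 * dot e x) / Den t) @[t --> (0 : R)] -->
      (0 * (1 - dot x x) - 2 * dot e x) / Den 0.
    exact: (cvgM (cvgB (cvgM cid (cvg_cst (1 - dot x x)))
      (cvg_cst (2 * dot e x))) (cvgV DenV cDen)).
  exact: (cvgD c1 (cvgZ c2 (cvg_cst e))).
have cphi0 : phi y @[y --> Y 0] --> phi (Y 0) by exact: cphi.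
have cpY : phi (Y t) @[t --> (0 : R)] --> phi (Y 0).
  exact: (@cvg_comp _ _ _ Y phi _ _ _ cY cphi0).
have M01 : 0 < M 0 by rewrite M0.
have cpow : {for M 0, continuous (fun a : R => a `^ b)}.
  exact: (is_derive_continuous1 (is_derive1_powR _ M01)).
have cMb : M t `^ b @[t --> (0 : R)] --> M 0 `^ b.
  exact: (@cvg_comp _ _ _ M (fun a : R => a `^ b) _ _ _ cM cpow).
have ch : M t `^ b * phi (Y t) @[t --> (0 : R)] --> M 0 `^ b * phi (Y 0).
  exact: (cvgM cMb cpY).
rewrite -Y0 leNgt; apply/negP => hlt.
have hlt' : M 0 `^ b * phi (Y 0) < phi x by rewrite M0 powR1 mul1r.
have n1 : \forall t \near (0 : R), M t `^ b * phi (Y t) < phi x.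
  exact: (cvgr_lt _ ch _ hlt').
have [d /= d0 Hd] := n1.
pose t := Num.min (d / 2) (dot e x).
have t0 : 0 < t by rewrite lt_min ex divr_gt0.
have td : t < d by rewrite gt_min ltr_pdivrMr// ltr_pMr// ltr1n.
have tex : t <= dot e x by rewrite ge_min lexx orbT.
have := Hd t; rewrite /ball_/= sub0r normrN gtr0_norm// => /(_ td).
apply/negP; rewrite -leNgt.
have tn : t != 0 by rewrite gt_eqF.
have Den_gt0 : 0 < Den t.
  by rewrite /Den ltr_wpDl// addr_ge0// !mulr_ge0// ?dot_ge0// ltW.
have Kx : ccap (t^-1 *: e) x.
  split; first exact: ltW.
  rewrite dotZl; have : 1 <= t^-1 * dot e x by rewrite mulrC ler_pdivlMr// mul1r.
  by have := dot_ge0 x; lra.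
have sE : sqd (t^-1 *: e) x = Den t / (t * t).
  by rewrite sqdE !dotE e1 /Den; field.
have mE : mu (t^-1 *: e) x = M t.
  rewrite /mu sE /kap !dotE e1 /M; field.
  by rewrite tn gt_eqF.
have iE : invc (t^-1 *: e) x = Y t.
  rewrite /invc mE /Y scalerDr -addrA; congr (_ + _).
  rewrite scalerA -scalerBl; congr (_ *: _); rewrite /M /Den; field.
  by rewrite -/(Den t) tn gt_eqF.
have := kelvin_above_all (s := t^-1) _ Kx; rewrite invr_gt0 => /(_ t0).
by rewrite /Wdiff /kelvin mE iE subr_ge0.
Qed.

(** The parameter s = (1 - r^2) / (2 r) puts r e on the fixed sphere. The ball of
    radius q around (r + q) e touches this sphere at r e from inside the cap, so
    the difference grows linearly from r e along the axis. *)
Lemma hopf_axis (r : R) : 0 < r < 1 ->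
  exists k rho : R, [/\ 0 < k, 0 < rho, r + rho < 1 & forall t, 0 <= t <= rho ->
    k * t <= Wdiff (((1 - r ^+ 2) / (2 * r)) *: e) ((r + t) *: e)].
Proof.
move=> /andP[r0 r1]; set s := (1 - r ^+ 2) / (2 * r).
have r2 : r ^+ 2 < 1 by rewrite expr_lt1// ltW.
have s0 : 0 < s by rewrite divr_gt0 ?mulr_gt0// subr_gt0.
have rs : r ^+ 2 + 2 * s * r = 1 by rewrite /s; field; rewrite gt_eqF.
pose q := (1 - r) / 3.
have q0 : 0 < q by rewrite divr_gt0// subr_gt0.
have q1 : r + 2 * q < 1 by rewrite /q; lra.
pose y := (r + q) *: e.
have Hin p : dot (p - y) (p - y) <= q ^+ 2 -> dot p p < 1 /\
    1 + 2 * (r + s) * q - (r + s) * (dot (p - y) (p - y) + q ^+ 2) / q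
      <= dot p p + 2 * dot (s *: e) p.
  have -> : p = (p - y) + y by rewrite subrK.
  rewrite addrK; move: (p - y) => h Hq.
  pose H := dot h h.
  have a1 := dot_ge0 (h + q *: e); have a2 := dot_ge0 (h - q *: e).
  rewrite !dotE e1 (dotC h e) -/H in a1 a2.
  have b1 : 2 * dot e h <= 2 * q.
    by rewrite -(ler_pM2l q0); rewrite -/H in Hq; lra.
  split.
    have e2 : dot (h + y) (h + y) = H + (r + q) * (2 * dot e h) + (r + q) ^+ 2.
      by rewrite /y !dotE e1 (dotC h e) -/H; ring.
    have : (r + q) * (2 * dot e h) <= (r + q) * (2 * q).
      by rewrite ler_wpM2l// addr_ge0// ltW.
    have : (r + 2 * q) ^+ 2 < 1 by rewrite expr_lt1// addr_ge0 ?(ltW r0)//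
      mulr_ge0// ltW.
    by rewrite e2; rewrite -/H in Hq; lra.
  have e3 : dot (h + y) (h + y) + 2 * dot (s *: e) (h + y) =
      H + (r + q + s) * (2 * dot e h) + (r + q) ^+ 2 + 2 * s * (r + q).
    by rewrite /y !dotE e1 (dotC h e) -/H; ring.
  have : (r + q + s) * (- (H + q ^+ 2) / q) <= (r + q + s) * (2 * dot e h).
    rewrite ler_wpM2l//; first by rewrite !addr_ge0// ltW.
    by rewrite ler_pdivrMr//; lra.
  rewrite e3 -/H.
  have -> : (r + q + s) * (- (H + q ^+ 2) / q) =
      - ((r + s) * (H + q ^+ 2) / q) - H - q ^+ 2 by field; rewrite gt_eqF.
  by lra.
have Hcc p : dot (p - y) (p - y) <= q ^+ 2 -> ccap (s *: e) p.
  move=> hq; have [h1 h2] := Hin p hq; split; first exact: ltW.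
  apply: le_trans h2; rewrite -subr_ge0.
  have -> : 1 + 2 * (r + s) * q - (r + s) * (dot (p - y) (p - y) + q ^+ 2) / q - 1
    = (r + s) * ((q ^+ 2 - dot (p - y) (p - y)) / q) by field; rewrite gt_eqF.
  by rewrite mulr_ge0 ?addr_ge0 ?(ltW r0) ?(ltW s0)// divr_ge0 ?(ltW q0)// subr_ge0.
have Hc p : dot (p - y) (p - y) < q ^+ 2 -> cap (s *: e) p.
  move=> hq; have [h1 h2] := Hin p (ltW hq); split=> //.
  apply: lt_le_trans h2; rewrite -subr_gt0.
  have -> : 1 + 2 * (r + s) * q - (r + s) * (dot (p - y) (p - y) + q ^+ 2) / q - 1
    = (r + s) * ((q ^+ 2 - dot (p - y) (p - y)) / q) by field; rewrite gt_eqF.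
  by rewrite mulr_gt0 ?addr_gt0// divr_gt0// subr_gt0.
have gs := kelvin_above_all s0.
have qq0 : 0 < q ^+ 2 by rewrite exprn_gt0.
have Wy : 0 < Wdiff (s *: e) y.
  by apply: kelvin_above_strict => //; apply: Hc; rewrite subrr dot0l.
have [k k0 Hk] := supersol_hopf C0 qq0
  (fun p hp => Wdiff_continuous (ccap_sqd_gt0 (Hcc p hp)))
  (fun p hp => gs p (Hcc p hp)) (supersolS Hc (@sW (s *: e))) Wy.
exists (k * q), q; split => //; first exact: mulr_gt0.
  by lra.
move=> t /andP[t0 tq].
have E : dot ((r + t) *: e - y) ((r + t) *: e - y) = (t - q) ^+ 2.
  by rewrite /y -scalerBl !dotE e1; ring.
have := Hk ((r + t) *: e); rewrite E.
have h1 : (t - q) ^+ 2 = q ^+ 2 - t * (2 * q - t) by ring.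
have h2 : t * q <= t * (2 * q - t) by rewrite ler_wpM2l//; lra.
rewrite h1 => /(_ ltac:(have := mulr_ge0 t0 (ltW q0); lra)).
apply: le_trans; rewrite opprB addrC subrK -mulrA ler_pM2l// mulrC.
exact: h2.
Qed.

End MovingSpheres.

(** * Bounded second differences give derivability *)

Section SecondDifferences.
Variable R : realType.
Implicit Types (k : R -> R) (a b c E : R).

(** The second divided difference of k at a, b, c, up to sign and multiplied by
    the product of the three gaps; it is alternating, so a bound for ordered
    triples gives one for all. *)
Definition second_diff k a b c := k a * (c - b) + k b * (a - c) + k c * (b - a).

Lemma second_diff_bound k (P : pred R) E :
  (forall a b c, P a -> P b -> P c -> a < b -> b < c ->
     `|second_diff k a b c| <= E * ((b - a) * (c - b) * (c - a))) ->
  forall a b c, P a -> P b -> P c ->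
     `|second_diff k a b c| <= E * `|(b - a) * (c - b) * (c - a)|.
Proof.
move=> H.
have sw a b c : `|second_diff k a b c| <= E * `|(b - a) * (c - b) * (c - a)| ->
    `|second_diff k b a c| <= E * `|(a - b) * (c - a) * (c - b)|.
  have -> : second_diff k b a c = - second_diff k a b c by rewrite /second_diff; ring.
  have -> : (a - b) * (c - a) * (c - b) = - ((b - a) * (c - b) * (c - a)) by ring.
  by rewrite !normrN.
have sw' a b c : `|second_diff k a b c| <= E * `|(b - a) * (c - b) * (c - a)| ->
    `|second_diff k a c b| <= E * `|(c - a) * (b - c) * (b - a)|.
  have -> : second_diff k a c b = - second_diff k a b c by rewrite /second_diff; ring.
  have -> : (c - a) * (b - c) * (b - a) = - ((b - a) * (c - b) * (c - a)) by ring.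
  by rewrite !normrN.
have eq0 a b : second_diff k a a b = 0 by rewrite /second_diff; ring.
have base a b c : P a -> P b -> P c -> a <= b -> b <= c ->
    `|second_diff k a b c| <= E * `|(b - a) * (c - b) * (c - a)|.
  move=> Pa Pb Pc; rewrite le_eqVlt => /predU1P[->|ab].
    by rewrite eq0 subrr !mul0r normr0 mulr0.
  rewrite le_eqVlt => /predU1P[->|bc].
    have -> : second_diff k a c c = 0 by rewrite /second_diff; ring.
    by rewrite normr0 subrr mulr0 mul0r normr0 mulr0.
  rewrite (ger0_norm (x := _ * _)) ?H// !mulr_ge0// subr_ge0 ltW//.
  exact: lt_trans ab bc.
move=> a b c Pa Pb Pc.
have [ab|/ltW ba] := leP a b; have [bc|/ltW cb] := leP b c.
- exact: base.
- have [ac|/ltW ca] := leP a c; first exact/sw'/base.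
  exact/sw'/sw/base.
- have [ac|/ltW ca] := leP a c; first exact/sw/base.
  exact/sw/sw'/base.
- exact/sw/sw'/sw/base.
Qed.

(** Bounded second divided differences make the difference quotient at p
    Lipschitz in the increment, hence Cauchy. *)
Lemma derivable_of_second_diff k (p d E : R) : 0 < d -> 0 <= E ->
  (forall a b c, `|a - p| < d -> `|b - p| < d -> `|c - p| < d ->
     `|second_diff k a b c| <= E * `|(b - a) * (c - b) * (c - a)|) ->
  derivable k p 1.
Proof.
move=> d0 E0 H.
pose q (h : R) := h^-1 * (k (h + p) - k p).
rewrite /derivable (_ : (fun h : R => _) = q); last first.
  by apply/funext => h; rewrite /= [h *: 1]mulr1.
apply: cauchy_cvg; apply: cauchy_exP => eps eps0.
have qq h h' : h != 0 -> h' != 0 -> `|h| < d -> `|h'| < d ->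
    `|q h - q h'| <= E * `|h - h'|.
  move=> h0 h'0 hd h'd.
  have := H p (h + p) (h' + p); rewrite subrr normr0 d0 !addrK hd h'd.
  move=> /(_ isT isT isT).
  have -> : second_diff k p (h + p) (h' + p) = (h * h') * (q h' - q h).
    rewrite /q /second_diff.
    by field; rewrite h0 h'0.
  have -> : h * (h' + p - (h + p)) * h' = (h * h') * (h' - h) by ring.
  rewrite !(normrM (h * h')) mulrCA ler_pM2l ?normr_gt0 ?mulf_neq0//.
  by rewrite distrC (distrC h').
pose r := Num.min d (eps / (2 * (E + 1))).
have r0 : 0 < r by rewrite lt_min d0 divr_gt0// mulr_gt0// ltr_wpDl.
have rd : r <= d by rewrite ge_min lexx.
have re : 2 * (E + 1) * r <= eps.
  by rewrite mulrC -ler_pdivlMr ?mulr_gt0 ?ltr_wpDl// ge_min lexx orbT.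
exists (q (r / 2)); exists r => //= h; rewrite /ball_/= sub0r normrN => hr h0.
have r2 : 0 < r / 2 by rewrite divr_gt0.
rewrite /ball/= -/(q h).
apply: le_lt_trans (qq (r / 2) h _ h0 _ _) _; rewrite ?gt_eqF//.
- rewrite gtr0_norm//; lra.
- exact: lt_le_trans hr rd.
have : `|r / 2 - h| <= r / 2 + r.
  by rewrite (le_trans (ler_normB _ _))// gtr0_norm// lerD2l ltW.
move=> /(ler_wpM2l E0); have := mulr_ge0 E0 (ltW r0); lra.
Qed.

End SecondDifferences.

(** * Radial functions and their profile *)

Section Radial.
Variables (R : realType) (N : nat).
Notation V := 'rV[R]_N.
Implicit Types x y e : V.

(** Two points of equal norm are exchanged by the reflection along their
    difference. *)
Lemma radial_of_reflections (phi : V -> R) :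
  (forall e x, dot e e = 1 -> dot x x < 1 -> 0 < dot e x ->
     phi x <= phi (x - (2 * dot e x) *: e)) ->
  forall x y, dot x x < 1 -> dot x x = dot y y -> phi x = phi y.
Proof.
move=> H.
have le x y : dot x x < 1 -> dot x x = dot y y -> phi x <= phi y.
  move=> x1 xy; have [->//|xny] := eqVneq x y.
  have [v vE] : exists v, v = x - y by exists (x - y).
  have v0 : 0 < dot v v by rewrite dotxx_gt0 vE subr_eq0.
  pose n := Num.sqrt (dot v v).
  have n0 : 0 < n by rewrite sqrtr_gt0.
  have nn : n * n = dot v v by rewrite -expr2 sqr_sqrtr// ltW.
  have vx : dot v v = 2 * dot v x by rewrite vE !dotE (dotC y x) -xy; ring.
  pose e := n^-1 *: v.
  have e1 : dot e e = 1 by rewrite /e !dotE -nn; field; rewrite gt_eqF.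
  have ex : 2 * dot e x = n by rewrite /e !dotE mulrCA -vx -nn; field; rewrite gt_eqF.
  have ex0 : 0 < dot e x by rewrite -(pmulr_rgt0 _ (ltr0Sn R 1)) ex.
  have := H e x e1 x1 ex0.
  by rewrite ex /e scalerA divff ?gt_eqF// scale1r vE subKr.
by move=> x y x1 xy; apply/eqP; rewrite eq_le !le// -xy.
Qed.

Variable e : V.
Hypothesis e1 : dot e e = 1.

(** The profile as a function of the squared radius: this makes test functions
    polynomials in |x|^2. *)
Definition profile2 (W : V -> R) (p : R) := W (Num.sqrt p *: e).

Lemma dot_profile p : 0 <= p -> dot (Num.sqrt p *: e) (Num.sqrt p *: e) = p.
Proof. by move=> p0; rewrite !dotE e1 mulr1 -expr2 sqr_sqrtr. Qed.

Lemma profile2_continuous W : continuous W -> continuous (profile2 W).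
Proof.
move=> cW p.
have c1 : (Num.sqrt q *: e) @[q --> p] --> Num.sqrt p *: e.
  exact: (cvgZ (@sqrt_continuous R p) (cvg_cst e)).
have c2 : W x @[x --> Num.sqrt p *: e] --> W (Num.sqrt p *: e) by exact: cW.
exact: (@cvg_comp _ _ _ (fun q => Num.sqrt q *: e) W _ _ _ c1 c2).
Qed.

(** The profile lies above its chord minus a parabola. If it did not, a parabola
    of second derivative E over the interval would touch it from below; the
    Lipschitz bound controls the slope at the touching point, so the Laplacian of
    the corresponding radial function is at least 4 a E - 2 N La > D. *)
Lemma chord_lower (W : V -> R) (D a La : R) : continuous W ->
  (forall x, dot x x < 1 -> W x = profile2 W (dot x x)) ->
  supersol [set x | 0 < dot x x < 1] 0 D W ->
  0 < a -> (forall p q, a <= p -> a <= q -> p < 1 -> q < 1 ->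
    `|profile2 W p - profile2 W q| <= La * `|p - q|) ->
  exists2 E : R, 0 <= E & forall p1 m p2, a <= p1 -> p2 < 1 -> p1 < m -> m < p2 ->
    second_diff (profile2 W) p1 m p2 <= E * ((m - p1) * (p2 - m) * (p2 - p1)).
Proof.
move=> cW radW sW a0 lipW; set k := profile2 W.
pose E := `|D + 2 * N%:R * La| / (4 * a) + 1.
have E1 : 1 <= E by rewrite lerDr divr_ge0// mulr_ge0// ltW.
have ED : D + 2 * N%:R * La < 4 * a * E.
  have -> : 4 * a * E = `|D + 2 * N%:R * La| + 4 * a.
    by rewrite /E; field; rewrite gt_eqF.
  by have := ler_norm (D + 2 * N%:R * La); have := mulr_gt0 (ltr0Sn R 3) a0; lra.
exists (E / 2); first by rewrite divr_ge0//; lra.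
move=> p1 m p2 ap1 p21 p1m mp2.
have p12 : p1 < p2 := lt_trans p1m mp2.
pose sg := (k p2 - k p1) / (p2 - p1).
pose G (p : R) : R := k p1 + sg * (p - p1) - E / 2 * ((p - p1) * (p2 - p)).
pose G1 (p : R) : R := sg - E / 2 * (p2 + p1 - 2 * p).
have dG (p : R) : is_derive p 1 G (G1 p).
  have h1 := is_derive_funD (is_derive_fun_id p) (is_derive_funC (- p1) p 1).
  have h2 := is_derive_funD (is_derive_funC p2 p 1) (is_derive_funN
    (is_derive_fun_id p)).
  have := is_derive_funD (is_derive_funD (is_derive_funC (k p1) p 1)
    (is_derive_funZ sg h1)) (is_derive_funN (is_derive_funZ (E / 2) (is_derive_funM
      h1 h2))).
  by congr (is_derive _ _ _ _); rewrite /G1; ring.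
have dG1 (p : R) : is_derive p 1 G1 E.
  have h2 := is_derive_funD (is_derive_funC (p2 + p1) p 1) (is_derive_funN
    (is_derive_funZ 2 (is_derive_fun_id p))).
  have := is_derive_funD (is_derive_funC sg p 1) (is_derive_funN (is_derive_funZ (E
    / 2) h2)).
  by congr (is_derive _ _ _ _); field.
have Gp1 : G p1 = k p1 by rewrite /G !subrr mulr0 mul0r mulr0 subr0 addr0.
have Gp2 : G p2 = k p2.
  by rewrite /G subrr !mulr0 subr0 /sg divfK ?gt_eqF ?subr_gt0// addrC subrK.
suff kG p : p1 <= p <= p2 -> G p <= k p.
  have := kG m ltac:(by rewrite (ltW p1m) (ltW mp2)).
  have h : 0 < p2 - p1 by rewrite subr_gt0.
  rewrite -(ler_pM2r h).
  have -> : G m * (p2 - p1) = k p1 * (p2 - m) + k p2 * (m - p1)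
      - E / 2 * ((m - p1) * (p2 - m) * (p2 - p1)).
    by rewrite /G /sg; field; rewrite gt_eqF.
  rewrite /second_diff; lra.
have ck : {within `[p1, p2], continuous (fun p => k p - G p)}.
  apply: continuous_in_subspaceT => t _.
  have c1 : k q @[q --> t] --> k t by exact: profile2_continuous.
  have c2 : G q @[q --> t] --> G t by exact: (is_derive_continuous1 (dG t)).
  exact: (cvgB c1 c2).
have [p0] := EVT_min (ltW p12) ck.
rewrite in_itv/= => /andP[p10 p02] minp0 pp.
rewrite -subr_ge0; apply: le_trans (minp0 p _); last by rewrite in_itv.
rewrite leNgt; apply/negP => neg.
have p10' : p1 < p0.
  by rewrite lt_neqAle p10 andbT; apply/eqP => h; rewrite -h Gp1 subrr ltxx in neg.
have p02' : p0 < p2.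
  by rewrite lt_neqAle p02 andbT; apply/eqP => h; rewrite h Gp2 subrr ltxx in neg.
have p00 : 0 < p0 by lra.
pose psi x := G (dot (x - 0) (x - 0)).
pose L x := 4 * dot (x - 0) (x - 0) * E + 2 * N%:R * G1 (dot (x - 0) (x - 0)).
have cpsi : continuous psi.
  move=> x; have cG := is_derive_continuous1 (dG (dot (x - 0) (x - 0))).
  exact: (@cvg_comp _ _ _ (fun x => dot (x - 0) (x - 0)) G _ _ _
    (@dot_shift_continuous R N 0 x) cG).
have cL : continuous L.
  move=> x; have cG := is_derive_continuous1 (dG1 (dot (x - 0) (x - 0))).
  have h : G1 (dot (y - 0) (y - 0)) @[y --> x] --> G1 (dot (x - 0) (x - 0)).
    exact: (@cvg_comp _ _ _ (fun x => dot (x - 0) (x - 0)) G1 _ _ _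
      (@dot_shift_continuous R N 0 x) cG).
  exact: (cvgD (cvgM (cvgM (cvg_cst (4 : R)) (@dot_shift_continuous R N 0 x))
    (cvg_cst E))
    (cvgM (cvg_cst (2 * N%:R : R)) h)).
have lpsi x : has_lap psi x (L x).
  by apply: has_lap_radial; exists 1 => //= q _; exact: dG.
pose x0 := Num.sqrt p0 *: e.
have x0p : dot x0 x0 = p0 by apply: dot_profile; exact: ltW.
have x01 : dot x0 x0 < 1 by rewrite x0p; lra.
have touch : \forall x \near x0, W x0 - psi x0 <= W x - psi x.
  have n1 : \forall x \near x0, p1 < dot x x.
    by apply: (cvgr_gt _ (@dotxx_continuous R N x0)); rewrite x0p.
  have n2 : \forall x \near x0, dot x x < p2.
    by apply: (cvgr_lt _ (@dotxx_continuous R N x0)); rewrite x0p.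
  apply: nearS2 n1 n2 => x h1 h2.
  have x1 : dot x x < 1 by lra.
  rewrite (radW x0 x01) (radW x x1) /psi !subr0 x0p.
  by apply: minp0; rewrite in_itv/= !ltW.
have x001 : 0 < dot x0 x0 < 1 by rewrite x01 x0p p00.
have := sW x0 x001 psi L cpsi cL lpsi touch.
rewrite mul0r add0r /L subr0 x0p => HL.
have G1p : - La <= G1 p0.
  have h : k p0 - G p0 <= k p1 - G p1 by apply: minp0; rewrite in_itv/= lexx ltW.
  have hl := lipW p0 p1 (le_trans ap1 p10) ap1 (lt_trans p02' p21) (lt_trans p12 p21).
  have hn : `|p0 - p1| = p0 - p1 by rewrite ger0_norm ?subr_ge0.
  rewrite hn in hl.
  have hl2 : - (La * (p0 - p1)) <= k p0 - k p1.
    by have := ler_norm (- (k p0 - k p1)); rewrite normrN; rewrite -/k in hl; lra.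
  have eG : G p0 = G p1 + G1 p0 * (p0 - p1) - E / 2 * (p0 - p1) ^+ 2.
    by rewrite /G /G1; field.
  have hh : 0 <= E / 2 * (p0 - p1) ^+ 2 by rewrite mulr_ge0 ?sqr_ge0// divr_ge0//;
    lra.
  have p3 : 0 < p0 - p1 by rewrite subr_gt0.
  by rewrite -(ler_pM2r p3); rewrite Gp1 in eG; lra.
have t1 : 2 * N%:R * (- La) <= 2 * N%:R * G1 p0 by rewrite ler_wpM2l// mulr_ge0.
have t2 : 4 * a * E <= 4 * p0 * E by rewrite ler_pM2r; lra.
lra.
Qed.

Lemma profile2_derivable (W : V -> R) (D : R) : continuous W ->
  (forall x, dot x x < 1 -> W x = profile2 W (dot x x)) ->
  supersol [set x | 0 < dot x x < 1] 0 D W ->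
  supersol [set x | 0 < dot x x < 1] 0 D (fun x => - W x) ->
  (forall a : R, 0 < a -> exists La : R, forall p q, a <= p -> a <= q -> p < 1 ->
    q < 1 -> `|profile2 W p - profile2 W q| <= La * `|p - q|) ->
  forall p : R, 0 < p < 1 -> derivable (profile2 W) p 1.
Proof.
move=> cW radW s1 s2 lip p /andP[p0 p1].
have a0 : 0 < p / 2 by rewrite divr_gt0.
have [La lipa] := lip _ a0.
have [E1 E10 H1] := chord_lower cW radW s1 a0 lipa.
have cNW : continuous (fun x => - W x) by move=> x; exact: (cvgN (cW x)).
have radNW x : dot x x < 1 -> - W x = profile2 (fun x => - W x) (dot x x).
  by move=> /radW ->.
have lipN q r : p / 2 <= q -> p / 2 <= r -> q < 1 -> r < 1 ->
    `|profile2 (fun x => - W x) q - profile2 (fun x => - W x) r| <= La * `|q - r|.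
  by rewrite /profile2 -opprD normrN; exact: lipa.
have [E2 E20 H2] := chord_lower cNW radNW s2 a0 lipN.
pose d := Num.min (p / 2) (1 - p).
have d0 : 0 < d by rewrite lt_min a0 subr_gt0.
have dl : d <= p / 2 by rewrite ge_min lexx.
have dr : d <= 1 - p by rewrite ge_min lexx orbT.
apply: (@derivable_of_second_diff _ _ p d (E1 + E2)) => //; first exact: addr_ge0.
have B := @second_diff_bound R (profile2 W) [pred q : R | (p / 2 <= q) && (q < 1)]
  (E1 + E2).
move=> a b c; rewrite !ltr_norml => /andP[a1 a2] /andP[b1 b2] /andP[c1 c2].
apply: B; rewrite ?inE; [|lra|lra|lra].
move=> {a1 a2 b1 b2 c1 c2} {}a {}b {}c; rewrite !inE.
move=> /andP[a1 a2] /andP[b1 b2] /andP[c1 c2] ab bc.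
have := H1 a b c a1 c2 ab bc; have := H2 a b c a1 c2 ab bc.
have -> : second_diff (profile2 (fun x => - W x)) a b c = - second_diff (profile2
  W) a b c.
  by rewrite /second_diff /profile2; ring.
have Z : 0 <= (b - a) * (c - b) * (c - a).
  by rewrite !mulr_ge0// subr_ge0 ltW// (lt_trans ab bc).
have := mulr_ge0 E10 Z; have := mulr_ge0 E20 Z.
move: ((b - a) * (c - b) * (c - a)) => z; rewrite ler_norml mulrDl; lra.
Qed.

Lemma slope_ge (F : R -> R) (D k rho : R) : is_derive (0 : R) 1 F D -> F 0 = 0 ->
  0 < rho -> (forall t, 0 <= t <= rho -> k * t <= F t) -> k <= D.
Proof.
move=> [dF <-] F0 rho0 H; rewrite leNgt; apply/negP => lt.
have C : h^-1 *: ((F \o shift (0 : R)) (h *: 1) - F 0) @[h --> 0^'] --> 'D_1 F 0.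
  exact: dF.
have [s /= s0 Hs] := cvgr_lt _ C _ lt.
pose h := Num.min (s / 2) rho.
have h0 : 0 < h by rewrite lt_min rho0 divr_gt0.
have hs : h < s by rewrite gt_min ltr_pdivrMr// ltr_pMr// ltr1n.
have hr : h <= rho by rewrite ge_min lexx orbT.
have := Hs h; rewrite /ball_/= sub0r normrN gtr0_norm// => /(_ hs).
rewrite gt_eqF// => /(_ isT); rewrite [h *: 1]mulr1 addr0 F0 subr0.
have -> : h^-1 *: F h = F h / h by exact: mulrC.
by rewrite ltr_pdivrMr// ltNge H// (ltW h0).
Qed.

End Radial.

(** * The increasing limit of the solution *)

Section Limit.
Variables (R : realType) (N : nat).
Notation V := 'rV[R]_N.
Implicit Types x y e : V.

Lemma cvg_sum_ord (T : Type) (F : set_system T) {FF : Filter F}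
    (f : 'I_N -> T -> R) (a : 'I_N -> R) :
  (forall i, f i t @[t --> F] --> a i) ->
  \sum_i f i t @[t --> F] --> \sum_i a i.
Proof.
by move=> h; apply: cvg_big => [|i _]; [exact: add_continuous|exact: h].
Qed.

Lemma cylinderE x (t : R) : cylinder R N (x, t) <-> dot x x < 1 /\ 0 < t.
Proof. by split=> -[/unit_ballE ? ?]. Qed.

Lemma cylinder_open : open (cylinder R N).
Proof.
have -> : cylinder R N = [set p | dot p.1 p.1 < 1] `&` [set p | 0 < p.2].
  by apply/seteqP; split => -[x t] /=; rewrite cylinderE.
apply: openI.
  apply: (@open_comp _ _ (fun p : V * R => dot p.1 p.1) [set z | z < 1]) => [p _|].
    have c1 : q.1 @[q --> p] --> p.1 by exact: cvg_fst.
    exact: (cvg_dot c1 c1).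
  exact: open_lt.
apply: (@open_comp _ _ (fun p : V * R => p.2) [set z | 0 < z]) => [p _|].
  exact: cvg_snd.
exact: open_gt.
Qed.

Lemma cylinder_cvg (F : V * R -> R) x (t : R) : {within cylinder R N, continuous F} ->
  dot x x < 1 -> 0 < t -> F p @[p --> (x, t)] --> F (x, t).
Proof.
rewrite continuous_open_subspace; last exact: cylinder_open.
by move=> cF x1 t0; apply: cF; rewrite inE; exact/cylinderE.
Qed.

Lemma cylinder_cvg_slice (F : V * R -> R) x (t : R) :
  {within cylinder R N, continuous F} -> dot x x < 1 -> 0 < t ->
  F (y, t) @[y --> x] --> F (x, t).
Proof.
move=> cF x1 t0.
have c1 : (y, t) @[y --> x] --> (x, t).
  exact: (cvg_pair (@cvg_id _ (nbhs x)) (cvg_cst t)).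
exact: (@cvg_comp _ _ _ (fun y => (y, t)) F _ _ _ c1 (cylinder_cvg cF x1 t0)).
Qed.

Lemma uball_open : open [set x : V | dot x x < 1].
Proof.
apply: (@open_comp _ _ (fun x : V => dot x x) [set z | z < 1]) => [x _|].
  exact: dotxx_continuous.
exact: open_lt.
Qed.

Variable (u : V -> R -> R).
Hypothesis hu : C21 u.

Definition slice_d1 (t : R) i x := partial i (u^~ t) x.
Definition slice_d2 (t : R) i j x := partial j (partial i (u^~ t)) x.

Lemma C2on_slice (t : R) : 0 < t ->
  C2on [set x | dot x x < 1] (u^~ t) (slice_d1 t) (slice_d2 t).
Proof.
move=> t0 x /= x1; have [_ _ _ hu1 hu2] := hu.
have cyl : cylinder R N (x, t) by exact/cylinderE.
split.
- by move=> i; have [h _] := hu1 i; exact: (derivableP (h _ cyl)).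
- by move=> i j; have [h _] := hu2 i j; exact: (derivableP (h _ cyl)).
- move=> i; have [_ h] := hu1 i.
  exact: (@cylinder_cvg_slice (fun p => partial i (u^~ p.2) p.1)).
- move=> i j; have [_ h] := hu2 i j.
  exact: (@cylinder_cvg_slice (fun p => partial j (partial i (u^~ p.2)) p.1)).
Qed.

Lemma has_lap_slice (t : R) x : 0 < t -> dot x x < 1 ->
  has_lap (u^~ t) x (laplacian (u^~ t) x).
Proof. by move=> t0 x1; exact: (C2on_lap uball_open (C2on_slice t0)). Qed.

Lemma is_derive_time x (t : R) : dot x x < 1 -> 0 < t ->
  is_derive t 1 (u x) (derive1 (u x) t).
Proof.
move=> x1 t0; have [_ h _ _ _] := hu; rewrite derive1E.
by apply: derivableP; apply: (h (x, t)); exact/cylinderE.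
Qed.

Lemma u_cvg x (t : R) : dot x x < 1 -> 0 < t ->
  u p.1 p.2 @[p --> (x, t)] --> u x t.
Proof. by move=> *; have [h _ _ _ _] := hu; exact: (cylinder_cvg h). Qed.

Lemma u_slice_cvg x (t : R) : dot x x < 1 -> 0 < t -> u y t @[y --> x] --> u x t.
Proof. by move=> *; have [h _ _ _ _] := hu; exact: (cylinder_cvg_slice h). Qed.

Lemma ut_slice_cvg x (t : R) : dot x x < 1 -> 0 < t ->
  derive1 (u y) t @[y --> x] --> derive1 (u x) t.
Proof.
by move=> *; have [_ _ h _ _] := hu; exact: (cylinder_cvg_slice h).
Qed.

Lemma lap_slice_cvg x (t : R) : dot x x < 1 -> 0 < t ->
  laplacian (u^~ t) y @[y --> x] --> laplacian (u^~ t) x.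
Proof.
move=> x1 t0; have [_ _ _ h] := C2on_slice t0 x1.
exact: (cvg_sum_ord (fun i => h i i)).
Qed.

Hypothesis hpos : forall x (t : R), dot x x < 1 -> 0 < t -> 0 < u x t.
Hypothesis hut : forall x (t : R), dot x x < 1 -> 0 < t -> 0 <= derive1 (u x) t.

Lemma u_nondecreasing x (s t : R) : dot x x < 1 -> 0 < s -> s <= t -> u x s <= u x t.
Proof.
move=> x1 s0 st.
apply: (@ger0_derive1_ndecr R (u x) s t) => //.
- move=> z; rewrite in_itv/= => /andP[sz _].
  by have [] := is_derive_time x1 (lt_trans s0 sz).
- by move=> z; rewrite in_itv/= => /andP[sz _]; apply: hut => //; exact: lt_trans sz.
- apply: derivable_within_continuous => z; rewrite in_itv/= => /andP[sz _].
  by have [] := is_derive_time x1 (lt_le_trans s0 sz).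
Qed.

Variable phi : V -> R.
Hypothesis homega : omega_limit u phi.

(** Along the defining sequence of the limit, arbitrarily late times are
    uniformly close to phi. *)
Lemma omega_seq (T d : R) : 0 < d -> exists2 s : R, T <= s &
  forall x, dot x x < 1 -> `|u x s - phi x| <= d.
Proof.
move=> d0; have [_ [t [tinf tunif]]] := homega.
have n1 : \forall k \near \oo, forall x, dot x x <= 1 -> `|u x (t k) - phi x| <= d.
  apply: (tunif [set h : V -> R | forall x, dot x x <= 1 -> `|h x - phi x| <= d]).
  apply/uniform_nbhs; exists [set p | ball p.1 d p.2]; split.
    exact: (@entourage_ball R R (PosNum d0)).
  move=> h /= H x x1; have := H x ((unit_cballE x).2 x1).
  by rewrite /ball/= distrC => /ltW.
have n2 : \forall k \near \oo, T <= t k by apply: (cvgryPge _).1.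
have [k [k1 k2]] := @filter_ex _ _ _ _ (filterI n1 n2).
by exists (t k) => // x /ltW; exact: k1.
Qed.

Lemma u_le_phi x (t : R) : dot x x < 1 -> 0 < t -> u x t <= phi x.
Proof.
move=> x1 t0; apply/ler_addgt0Pr => d d0.
have [s ts /(_ x x1)] := omega_seq t d0.
rewrite ler_norml => /andP[_ h].
by apply: le_trans (u_nondecreasing x1 t0 ts) _; lra.
Qed.

(** Monotonicity in time turns convergence along one sequence into convergence
    as t tends to infinity. *)
Lemma u_unif (d : R) : 0 < d -> exists2 T : R, 0 < T & forall t, T <= t ->
  forall x, dot x x < 1 -> `|u x t - phi x| <= d.
Proof.
move=> d0; have [s s1 Hs] := omega_seq 1 d0.
have s0 : 0 < s by lra.
exists s => // t st x x1; have := Hs x x1.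
have := u_nondecreasing x1 s0 st.
have := u_le_phi x1 (lt_le_trans s0 st).
by rewrite !ler_norml => *; lra.
Qed.

(** Extension by zero outside the ball, which is continuous on the whole space as
    phi vanishes on the sphere; it spares all one-sided continuity statements. *)
Definition ext0 x : R := if dot x x < 1 then phi x else 0.

Lemma ext0_in x : dot x x < 1 -> ext0 x = phi x.
Proof. by rewrite /ext0 => ->. Qed.

Lemma ext0_out x : 1 <= dot x x -> ext0 x = 0.
Proof. by rewrite /ext0 leNgt => /negPf ->. Qed.

Lemma ext0_gt0 x : dot x x < 1 -> 0 < ext0 x.
Proof.
by move=> x1; rewrite ext0_in//; apply: lt_le_trans (hpos x1 ltr01) (u_le_phi x1
  ltr01).
Qed.

Lemma ext0_cball x : unit_cball R N x -> phi x = ext0 x.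
Proof.
move=> /unit_cballE; rewrite le_eqVlt => /predU1P[x1|/ext0_in->//].
rewrite ext0_out ?x1//; have [[_ h] _] := homega; apply: h.
by rewrite /unit_sphere /= enormE x1 sqrtr1.
Qed.

Lemma ext0_continuous : continuous ext0.
Proof.
have [[cphi _] _] := homega.
move=> x; apply/(@cvgrPdist_lt R R V (nbhs x) (nbhs_filter x)) => eps eps0.
have near_in : unit_cball R N x ->
    \forall y \near x, unit_cball R N y -> `|phi x - phi y| < eps.
  move=> x1; have := (subspace_continuousP (unit_cball R N) phi).1 cphi x x1.
  by move=> /cvgrPdist_lt/(_ _ eps0).
have [x1|x1|x1] := ltgtP (dot x x) 1.
- have x1' : unit_cball R N x by exact/unit_cballE/ltW.
  have n : \forall y \near x, dot y y < 1.
    exact: (cvgr_lt _ (@dotxx_continuous R N x) _ x1).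
  apply: nearS2 (near_in x1') n => y H y1; rewrite !ext0_in//; apply: H.
  exact/unit_cballE/ltW.
- have n : \forall y \near x, 1 < dot y y.
    exact: (cvgr_gt _ (@dotxx_continuous R N x) _ x1).
  apply: nearS n => y y1.
  by rewrite !ext0_out ?(ltW x1) ?(ltW y1)// subrr normr0.
- have x1' : unit_cball R N x by apply/unit_cballE; rewrite x1.
  apply: nearS (near_in x1') => y H.
  have [y1|y1] := leP (dot y y) 1.
    have y1' : unit_cball R N y by exact/unit_cballE.
    by rewrite -(ext0_cball y1') -(ext0_cball x1') H.
  by rewrite !ext0_out ?(ltW y1) ?x1// subrr normr0.
Qed.

End Limit.

(** * From the equation to the supersolution property *)

Lemma comparison_arith (R : realType) (P m2 A ly B lx F W LW : R) :
  F <= P * m2 * (A - ly) -> m2 * B <= B -> m2 * (P * A - B) <= W ->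
  B - lx - F <= LW -> P * m2 * ly - lx <= 1 * W + LW + 0.
Proof. by lra. Qed.

Lemma gap_arith (R : realType) (a b k c : R) : `|a - b| <= k -> k + c < a -> c < b.
Proof. by rewrite ler_norml; lra. Qed.

Lemma oscillation_arith (R : realType) (a1 l1 a2 l2 K m : R) :
  `|a1 - l1 - (a2 - l2)| <= K -> `|a1| <= m -> `|a2| <= m ->
  `|l1 - l2| <= K + 2 * m.
Proof. by rewrite !ler_norml; lra. Qed.

Section Equation.
Variables (R : realType) (N : nat).
Notation V := 'rV[R]_N.
Implicit Types x y e : V.
Variables (alpha : R) (f : R -> R -> R -> R) (u : V -> R -> R) (phi : V -> R).
Hypotheses (hN : (2 <= N)%N) (halpha : 0 < alpha < 1)
  (hF1 : F1 f) (hF2 : F2 alpha f) (hF3 : F3 N f) (hu : C21 u).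
Variables (M Mt G : R).
Hypotheses (M0 : 0 < M)
  (hM : forall x (t : R), dot x x < 1 -> 0 < t -> `|u x t| <= M)
  (hpos : forall x (t : R), dot x x < 1 -> 0 < t -> 0 < u x t)
  (hpde : forall x (t : R), dot x x < 1 -> 0 < t ->
     derive1 (u x) t - laplacian (u^~ t) x = f (enorm x) (u x t) t)
  (hut : forall x (t : R), dot x x < 1 -> 0 < t -> 0 <= derive1 (u x) t)
  (hutM : forall x (t : R), dot x x < 1 -> 0 < t -> `|derive1 (u x) t| <= Mt)
  (hgrad : forall x (t : R), dot x x < 1 -> 0 < t -> enorm (grad (u^~ t) x) <= G)
  (homega : omega_limit u phi).

Let b : R := (N%:R - 2) / 2.

Lemma b_ge0 : 0 <= b.
Proof. by rewrite divr_ge0// subr_ge0 ler_nat. Qed.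

Lemma powR_le1 (m : R) : 0 <= m <= 1 -> 0 <= m `^ b <= 1.
Proof.
move=> /andP[m0 m1]; rewrite powR_ge0/= -[leRHS](congr1 (@^~ b) (@powR1 R)).
by apply: ge0_ler_powR; rewrite ?b_ge0 ?nnegrE.
Qed.

Lemma powR_invl (z r : R) : 0 < z -> z^-1 `^ r = (z `^ r)^-1.
Proof.
by move=> z0; rewrite -(powR_inv1 (ltW z0)) -powRrM mulN1r powRN.
Qed.

Lemma enorm01 x : 0 < dot x x < 1 -> 0 < enorm x < 1.
Proof.
by move=> /andP[x0 x1]; rewrite enormE sqrtr_gt0 x0 -enormE enorm_ltP// expr1n.
Qed.

Let Q (t : R) y := derive1 (u y) t - laplacian (u^~ t) y.
Let ratio y x : R := (1 + dot y y) / (1 + dot x x).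

Lemma dot1_gt0 x : 0 < 1 + dot x x.
Proof. by rewrite ltr_pwDl// dot_ge0. Qed.

Lemma ratio01 x y : dot y y <= dot x x -> 0 < ratio y x <= 1.
Proof.
by move=> h; rewrite divr_gt0 ?dot1_gt0//= ler_pdivrMr ?dot1_gt0// mul1r lerD2l.
Qed.

(** The monotonicity hypothesis on f, read at the radii |y| < |x| and at the
    common value (1 + |y|^2)^b u(y, t) of the conformally weighted functions. *)
Lemma nonlinearity_comparison_off_centre x y (t : R) :
  0 < dot y y -> dot y y < dot x x -> dot x x < 1 -> 0 < t ->
  f (enorm x) (ratio y x `^ b * u y t) t
    <= ratio y x `^ b * ratio y x ^+ 2 * Q t y.
Proof.
move=> y0 yx x1 t0; have y1 := lt_trans yx x1.
have x0 := lt_trans y0 yx.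
have uy := hpos y1 t0.
pose U := (1 + dot y y) `^ b * u y t.
have U0 : 0 < U by rewrite mulr_gt0// powR_gt0// dot1_gt0.
have /andP[ey _] : 0 < enorm y < 1 by apply: enorm01; rewrite y0 y1.
have eyx : enorm y < enorm x by rewrite !enormE ltr_sqrt.
have /andP[_ ex] : 0 < enorm x < 1 by apply: enorm01; rewrite x0 x1.
have := hF3 (ltW t0) U0 ey eyx ex.
rewrite !enorm_sqr -/b.
have -> : (1 + dot y y) `^ (- b) * U = u y t.
  by rewrite /U mulrA -powRD ?addNr ?powRr0 ?mul1r// (gt_eqF (dot1_gt0 y)) implybT.
have -> : (1 + dot x x) `^ (- b) * U = ratio y x `^ b * u y t.
  rewrite /U /ratio mulrA powRM ?ltW ?dot1_gt0 ?invr_gt0 ?dot1_gt0//.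
  congr (_ * _); rewrite mulrC; congr (_ * _).
  by rewrite powRN powR_invl ?dot1_gt0.
have aE (z : R) : 0 < z -> z `^ ((N%:R + 2) / 2) = z `^ b * z ^+ 2.
  move=> z0; rewrite -powR_mulrn ?ltW// -powRD ?(gt_eqF z0) ?implybT//.
  by congr (_ `^ _); rewrite /b; field.
rewrite !aE ?dot1_gt0// -hpde// -/(Q t y) => /ltW.
have px := dot1_gt0 x; have py := dot1_gt0 y.
have rE : ratio y x `^ b = (1 + dot y y) `^ b / (1 + dot x x) `^ b.
  rewrite /ratio powRM ?ltW ?invr_gt0//; congr (_ * _).
  exact: powR_invl.
rewrite rE /ratio; have px' : 0 < (1 + dot x x) `^ b by rewrite powR_gt0.
move=> h; rewrite -(ler_pM2l (mulr_gt0 px' (exprn_gt0 2 px))).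
apply: le_trans h _; rewrite le_eqVlt; apply/orP; left; apply/eqP.
by field; rewrite !gt_eqF.
Qed.

Lemma Q_cvg x (t : R) : dot x x < 1 -> 0 < t -> Q t y @[y --> x] --> Q t x.
Proof.
by move=> x1 t0; exact: (cvgB (ut_slice_cvg hu x1 t0) (lap_slice_cvg hu x1 t0)).
Qed.

Lemma lip_f : exists2 L : R, 0 <= L & forall r v w t : R, 0 < r < 1 ->
  - M <= v <= M -> - M <= w <= M -> 0 <= t -> `|f r v t - f r w t| <= L * `|v - w|.
Proof.
have [L HL] := hF1 M0; exists `|L| => // r v w t r1 v1 w1 t0.
by apply: le_trans (HL r v w t r1 v1 w1 t0) _; rewrite ler_wpM2r// ler_norm.
Qed.

Lemma scaled_bound (p v : R) : 0 <= p <= 1 -> `|v| <= M -> - M <= p * v <= M.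
Proof.
move=> /andP[p0 p1] vM; rewrite -ler_norml normrM ger0_norm//.
by apply: le_trans vM; rewrite ler_piMl.
Qed.

(** The hypotheses on f do not reach the centre of the ball, but in the form
    u_t - Delta u the right-hand side of the equation is continuous there. *)
Lemma nonlinearity_comparison x y (t : R) :
  dot y y < dot x x -> dot x x < 1 -> 0 < t ->
  f (enorm x) (ratio y x `^ b * u y t) t
    <= ratio y x `^ b * ratio y x ^+ 2 * Q t y.
Proof.
move=> yx x1 t0; have [y0|y0] := ltP 0 (dot y y); first exact:
  nonlinearity_comparison_off_centre.
have {y0}y0 : y = 0.
  by apply/eqP; rewrite -dotxx_eq0 eq_le y0 dot_ge0.
have x0 : 0 < dot x x by apply: le_lt_trans yx; exact: dot_ge0.
have y1 := lt_trans yx x1.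
have [L L0 HL] := lip_f.
pose v z := ratio z x `^ b * u z t.
pose F z := f (enorm x) (v z) t.
pose S z := ratio z x `^ b * ratio z x ^+ 2 * Q t z.
have near_yx : \forall z \near y, dot z z < dot x x.
  exact: (cvgr_lt _ (@dotxx_continuous R N y) _ yx).
have cr : ratio z x @[z --> y] --> ratio y x.
  exact: (cvgM (cvgD (cvg_cst (1 : R)) (@dotxx_continuous R N y))
     (cvg_cst (1 + dot x x)^-1)).
have ry : 0 < ratio y x by have /andP[] := ratio01 (ltW yx).
have cpow : {for ratio y x, continuous (fun a : R => a `^ b)}.
  exact: (is_derive_continuous1 (is_derive1_powR _ ry)).
have crb : ratio z x `^ b @[z --> y] --> ratio y x `^ b.
  exact: (@cvg_comp _ _ _ (ratio ^~ x) (fun a : R => a `^ b) _ _ _ cr cpow).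
have cv : v z @[z --> y] --> v y by exact: (cvgM crb (u_slice_cvg hu y1 t0)).
have cS : S z @[z --> y] --> S y.
  have cr2 : ratio z x ^+ 2 @[z --> y] --> ratio y x ^+ 2 by exact: (cvgM cr cr).
  exact: (cvgM (cvgM crb cr2) (Q_cvg y1 t0)).
have vM z : dot z z < dot x x -> - M <= v z <= M.
  move=> zx; apply: scaled_bound; last exact: hM (lt_trans zx x1) t0.
  by have /andP[r0 r1] := ratio01 (ltW zx); apply: powR_le1; rewrite r1 ltW.
have cF : F z @[z --> y] --> F y.
  apply/(@cvgrPdist_lt R R V (nbhs y) (nbhs_filter y)) => eps eps0.
  have e1 : 0 < eps / (L + 1) by rewrite divr_gt0// ltr_wpDl.
  apply: nearS2 near_yx ((@cvgrPdist_lt R R V (nbhs y) (nbhs_filter y) _ _).1 cv _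
    e1) => z zx.
  rewrite ltr_pdivlMr ?ltr_wpDl// => h.
  apply: le_lt_trans (HL _ _ _ _ _ (vM y yx) (vM z zx) (ltW t0)) _.
    by apply: enorm01; rewrite x0.
  by apply: le_lt_trans h; rewrite mulrDr mulr1 mulrC lerDl.
rewrite -/(v y) -/(F y) -/(S y) leNgt; apply/negP => SF.
have n1 : \forall z \near y, S z - F z < 0.
  by apply: (cvgr_lt _ (cvgB cS cF)); rewrite subr_lt0.
have [r r0 Hr] := near_dotP (nearS2 (fun z a c => conj a c) n1 near_yx).
have i0 : 'I_N by exact: (Ordinal (ltnW hN)).
pose z : V := Num.sqrt r *: delta_mx 0 i0.
have zz : dot z z = r.
  by rewrite /z !dotE dot_delta !mxE !eqxx mulr1 -expr2 sqr_sqrtr// ltW.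
have [] := Hr z; first by rewrite y0 subr0 zz.
rewrite subr_lt0 => SF' zx.
have := @nonlinearity_comparison_off_centre x z t; rewrite zz => /(_ r0); rewrite
  -zz => /(_ zx x1 t0).
by rewrite -/(v z) -/(F z) -/(S z) leNgt SF'.
Qed.

Lemma cap_invc c x : cap c x ->
  [/\ 0 < sqd c x, 0 < mu c x <= 1, ratio (invc c x) x = mu c x,
      dot (invc c x) (invc c x) < dot x x & dot x x < 1].
Proof.
move=> [x1 cx]; have Kx : ccap c x by split; exact: ltW.
have S0 := ccap_sqd_gt0 Kx; have /andP[m0 m1] := ccap_mu Kx.
have E := invc_dot S0.
have m1' : mu c x < 1 by rewrite /mu ltr_pdivrMr// mul1r sqdE /kap; lra.
split => //; first by rewrite m0 m1.
  by rewrite /ratio E mulfK// gt_eqF// dot1_gt0.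
by rewrite -(ltrD2l 1) E gtr_pMl// dot1_gt0.
Qed.

(** The difference w of the Kelvin transform and of u satisfies
    Delta w <= mu^2 w_t + L |w| on the cap. The nonlinear terms are compared by
    [nonlinearity_comparison]; the time derivatives enter with the weights
    mu^2 < 1 and 1, and u_t >= 0 allows the larger weight to be lowered. *)
Lemma Wdiff_supersol (L : R) : 0 <= L ->
  (forall r v w t : R, 0 < r < 1 -> - M <= v <= M -> - M <= w <= M -> 0 <= t ->
     `|f r v t - f r w t| <= L * `|v - w|) ->
  forall c, supersol (cap c) L 0 (Wdiff (ext0 phi) c).
Proof.
move=> L0 HL c.
pose w x t := kelvin c (u^~ t) x - u x t.
pose wt x t := mu c x `^ b * derive1 (u (invc c x)) t - derive1 (u x) t.
apply: (@limit_supersol R N (cap c) w wt (Wdiff (ext0 phi) c) 1 L 0) => //.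
- exact: cap_open.
- move=> x t /cap_invc[S0 /andP[m0 m1] _ yx x1] t0.
  have c1 : p.1 @[p --> (x, t)] --> x by exact: cvg_fst.
  have c2 : p.2 @[p --> (x, t)] --> t by exact: cvg_snd.
  have k1 : mu c p.1 @[p --> (x, t)] --> mu c x by exact: (cvg_mu (cvg_cst c) c1 S0).
  have k2 : invc c p.1 @[p --> (x, t)] --> invc c x by exact: (cvg_invc (cvg_cst c)
    c1 S0).
  have cpow : {for mu c x, continuous (fun a : R => a `^ b)}.
    exact: (is_derive_continuous1 (is_derive1_powR _ m0)).
  have k3 : mu c p.1 `^ b @[p --> (x, t)] --> mu c x `^ b.
    exact: (@cvg_comp _ _ _ (fun p : V * R => mu c p.1) (fun a : R => a `^ b) _ _ _
      k1 cpow).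
  have k4 : (invc c p.1, p.2) @[p --> (x, t)] --> (invc c x, t) by exact: (cvg_pair
    k2 c2).
  have k5 : u (invc c p.1) p.2 @[p --> (x, t)] --> u (invc c x) t.
    exact: (@cvg_comp _ _ _ (fun p : V * R => (invc c p.1, p.2))
      (fun p : V * R => u p.1 p.2) _ _ _ k4 (u_cvg hu (lt_trans yx x1) t0)).
  exact: (cvgB (cvgM k3 k5) (u_cvg hu x1 t0)).
- move=> x t /cap_invc[S0 /andP[m0 m1] _ yx x1] t0.
  exact: (is_derive_funD (is_derive_funZ (mu c x `^ b) (is_derive_time hu (lt_trans
    yx x1) t0))
    (is_derive_funN (is_derive_time hu x1 t0))).
- move=> x t capx t0; have [S0 /andP[m0 m1] rE yx x1] := cap_invc capx.
  have y1 := lt_trans yx x1; set y := invc c x in yx y1 rE *.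
  exists (mu c x `^ b * mu c x ^+ 2 * laplacian (u^~ t) y - laplacian (u^~ t) x).
    apply: has_lapB (has_lap_slice hu t0 x1).
    exact: (has_lap_kelvin (@uball_open R N) (C2on_slice hu t0) S0 y1).
  have key := nonlinearity_comparison yx x1 t0; rewrite rE in key.
  have /andP[P0 P1] : 0 <= mu c x `^ b <= 1 by apply: powR_le1; rewrite m1 ltW.
  have uyb : - M <= mu c x `^ b * u y t <= M.
    by apply: scaled_bound; [rewrite P0 P1|exact: hM].
  have uxb : - M <= u x t <= M by rewrite -ler_norml; exact: hM.
  have x0 : 0 < dot x x by apply: le_lt_trans yx; exact: dot_ge0.
  have ex : 0 < enorm x < 1 by apply: enorm01; rewrite x0 x1.
  have := HL _ _ _ _ ex uxb uyb (ltW t0); rewrite -(hpde x1 t0).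
  have -> : `|u x t - mu c x `^ b * u y t| = `|w x t| by rewrite distrC.
  have m21 : mu c x ^+ 2 <= 1 by rewrite expr_le1// ltW.
  have utx := hut x1 t0.
  have h1 : mu c x ^+ 2 * derive1 (u x) t <= derive1 (u x) t by rewrite ler_piMl.
  have h2 : mu c x ^+ 2 * wt x t <= `|wt x t|.
    apply: le_trans (ler_norm _) _; rewrite normrM ger0_norm ?sqr_ge0//.
    by rewrite ler_piMl.
  move=> /(le_trans (ler_norm _)) h3.
  exact: (comparison_arith key h1 h2 h3).
- by move=> x /cap_invc[S0 _ _ _ _]; exact: (Wdiff_continuous (ext0_continuous
  homega)).
- move=> d d0.
  have d2 : 0 < d / 2 by rewrite divr_gt0.
  have [T T0 HT] := u_unif hu hut homega d2.
  exists T => t Tt x /cap_invc[S0 /andP[m0 m1] _ yx x1].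
  have y1 := lt_trans yx x1; set y := invc c x in yx y1 *.
  rewrite /w /Wdiff /kelvin -/y -/b !ext0_in//.
  have /andP[P0 P1] : 0 <= mu c x `^ b <= 1 by apply: powR_le1; rewrite m1 ltW.
  have hx := HT t Tt x x1; have hy := HT t Tt y y1.
  have -> : mu c x `^ b * u y t - u x t - (mu c x `^ b * phi y - phi x) =
    mu c x `^ b * (u y t - phi y) - (u x t - phi x) by ring.
  apply: le_trans (ler_normB _ _) _; rewrite normrM ger0_norm//.
  have : mu c x `^ b * `|u y t - phi y| <= `|u y t - phi y| by rewrite ler_piMl.
  by lra.
Qed.

(** Comparison with a paraboloid: a function whose Laplacian exceeds c on a ball
    oscillates there by at least a multiple of c r. *)
Lemma lap_le_of_bounded (w l : V -> R) (y : V) (r c K : R) : 0 < r ->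
  (forall x, dot (x - y) (x - y) <= r -> w z @[z --> x] --> w x) ->
  (forall x, dot (x - y) (x - y) <= r -> has_lap w x (l x)) ->
  (forall x, dot (x - y) (x - y) <= r -> `|w x| <= K) ->
  (forall x, dot (x - y) (x - y) <= r -> c < l x) ->
  c * r <= 4 * N%:R * K.
Proof.
move=> r0 cw lw wK cl.
have N0 : 0 < N%:R :> R by rewrite ltr0n (leq_trans _ hN).
pose k := c / (2 * N%:R).
have kE : k * (2 * N%:R) = c by rewrite /k divfK// gt_eqF// mulr_gt0.
have y0 : dot (y - y) (y - y) <= r by rewrite subrr dot0l ltW.
have cK := @closed_ball_compact R N y r.
have cf : {within [set x | dot (x - y) (x - y) <= r],
    continuous (fun x => k * dot (x - y) (x - y) - w x)}.
  apply: continuous_in_subspaceT => z; rewrite inE /= => qz.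
  exact: (cvgB (cvgM (cvg_cst k) (@dot_shift_continuous R N y z)) (cw z qz)).
have [x0] := compact_EVT_min (ex_intro _ y y0) cK cf.
rewrite inE /= => qx0 minx0.
have [qr|rq] := ltP (dot (x0 - y) (x0 - y)) r.
  have := has_lap_min (has_lapB (has_lapZ k (has_lap_sqdist y x0)) (lw x0 qx0)).
  rewrite kE subr_ge0 => H.
  have : l x0 <= c.
    apply: H; apply: nearS (near_dot_lt qr) => z /ltW qz.
    by apply: minx0; rewrite inE.
  by rewrite leNgt cl.
have qr : dot (x0 - y) (x0 - y) = r by apply/eqP; rewrite eq_le qx0 rq.
have := minx0 y; rewrite inE /= => /(_ y0); rewrite subrr dot0l mulr0 sub0r qr.
have := wK x0 qx0; have := wK y y0; rewrite !ler_norml => /andP[a1 a2] /andP[a3 a4] h.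
have : k * r <= 2 * K by lra.
rewrite -kE => h'; have N2 : 0 <= 2 * N%:R :> R by rewrite mulr_ge0// ltW.
have := ler_wpM2l N2 h'; lra.
Qed.

Lemma f_oscillation : exists2 K : R, 0 <= K & forall (t : R) x x',
  0 < dot x x < 1 -> 0 < dot x' x' < 1 -> 0 < t ->
  `|f (enorm x) (u x t) t - f (enorm x') (u x' t) t| <= K.
Proof.
have [L L0 HL] := lip_f.
have [H [e0 [e00 HH]]] := hF2.
exists (L * (M + M) + `|H|); first by rewrite addr_ge0// mulr_ge0// addr_ge0// ltW.
move=> t x x' x01 x'01 t0.
have ex := enorm01 x01; have ex' := enorm01 x'01.
have /andP[_ x1] := x01; have /andP[_ x'1] := x'01.
have xb : - M <= u x t <= M by rewrite -ler_norml; exact: hM.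
have x'b : - M <= u x' t <= M by rewrite -ler_norml; exact: hM.
rewrite -(subrKA (f (enorm x) (u x' t) t)).
apply: le_trans (ler_normD _ _) _; apply: lerD.
  apply: le_trans (HL _ _ _ _ ex xb x'b (ltW t0)) _; rewrite ler_wpM2l//.
  by apply: le_trans (ler_normB _ _) _; apply: lerD; exact: hM.
have tt : t - e0 <= t <= t + e0 by rewrite gerBl lerDl ltW.
apply: le_trans (HH t t0 (u x' t) _ _ t t (hpos x'1 t0) ex ex' tt tt (ltW t0) (ltW
  t0)) _.
have /andP[al0 al1] := halpha.
rewrite subrr normr0 powR0 ?addr0; last by rewrite gt_eqF// divr_gt0.
have p1 : `|enorm x - enorm x'| `^ alpha <= 1.
  rewrite -[leRHS](congr1 (@^~ alpha) (@powR1 R)).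
  apply: ge0_ler_powR; rewrite ?nnegrE ?(ltW al0)//.
  by move: ex ex' => /andP[? ?] /andP[? ?]; rewrite ler_norml; lra.
apply: le_trans (ler_norm _) _; rewrite normrM ler_piMr// ger0_norm ?powR_ge0//.
Qed.

(** By [F1] and [F2] the oscillation of f(|x|, u, t) over the ball is bounded at
    each time. So a large value of Delta u at one point would make Delta u large
    on a whole fixed ball away from the centre, which bounded u excludes. *)
Lemma lap_bounded : exists2 D : R, 0 <= D & forall (t : R) x,
  0 < dot x x < 1 -> 0 < t -> `|laplacian (u^~ t) x| <= D.
Proof.
have [K K0 HK] := f_oscillation.
have Mt0 : 0 <= Mt.
  have i0 : 'I_N by exact: (Ordinal (ltnW hN)).
  have := @hutM 0 1; rewrite dot0l => /(_ ltr01 ltr01).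
  exact: le_trans.
pose i0 : 'I_N := Ordinal (ltnW hN).
(* just above the bound of [lap_le_of_bounded] for a ball of squared radius 1/16 *)
pose c : R := 64 * N%:R * M + 1.
have [y yy] : exists y : V, dot y y = 4^-1.
  exists (2^-1 *: delta_mx 0 i0).
  by rewrite !dotE dot_delta !mxE !eqxx mulr1; field.
have inB x : dot (x - y) (x - y) <= 16^-1 -> 0 < dot x x < 1.
  have -> : x = (x - y) + y by rewrite subrK.
  rewrite addrK; move: (x - y) => h hh.
  have a1 := dot_ge0 (h - 2^-1 *: y); have a2 := dot_ge0 (h + 2^-1 *: y).
  rewrite !dotE (dotC y h) yy in a1 a2 *.
  by apply/andP; split; lra.
exists (K + 2 * Mt + c); first by rewrite !addr_ge0// ?mulr_ge0// ltW.
move=> t x x01 t0.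
have osc z : dot (z - y) (z - y) <= 16^-1 ->
    `|laplacian (u^~ t) x - laplacian (u^~ t) z| <= K + 2 * Mt.
  move=> /inB z01; have := HK t x z x01 z01 t0.
  have /andP[_ x1] := x01; have /andP[_ z1] := z01.
  rewrite -!hpde// => h.
  exact: (oscillation_arith h (hutM x1 t0) (hutM z1 t0)).
have r16 : 0 < 16^-1 :> R by rewrite invr_gt0.
have contra : ~ (c * 16^-1 <= 4 * N%:R * M).
  by rewrite /c => h; have : 0 < 16^-1 :> R by []; lra.
have cu z : dot (z - y) (z - y) <= 16^-1 -> u v t @[v --> z] --> u z t.
  by move=> /inB/andP[_ z1]; exact: u_slice_cvg.
have lu z : dot (z - y) (z - y) <= 16^-1 -> has_lap (u^~ t) z (laplacian (u^~ t) z).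
  by move=> /inB/andP[_ z1]; exact: has_lap_slice.
have Mu z : dot (z - y) (z - y) <= 16^-1 -> `|u z t| <= M.
  by move=> /inB/andP[_ z1]; exact: hM.
rewrite leNgt ltr_normr; apply/negP => /orP[h|h]; apply: contra.
  apply: (lap_le_of_bounded r16 cu lu Mu) => z /osc oz.
  exact: (gap_arith oz h).
apply: (lap_le_of_bounded r16 (w := fun z => - u z t)
  (l := fun z => - laplacian (u^~ t) z) (y := y)).
- by move=> z /cu h'; exact: (cvgN h').
- by move=> z /lu; exact: has_lapN.
- by move=> z /Mu; rewrite normrN.
- move=> z /osc oz; apply: gap_arith h; by rewrite -opprD normrN.
Qed.

Lemma phi_supersol : exists D : R,
  supersol [set x | 0 < dot x x < 1] 0 D (ext0 phi) /\
  supersol [set x | 0 < dot x x < 1] 0 D (fun x => - ext0 phi x).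
Proof.
have [D D0 HD] := lap_bounded.
have oO : open [set x : V | 0 < dot x x < 1].
  have -> : [set x : V | 0 < dot x x < 1] = [set x : V | 0 < dot x x] `&` [set x :
    V | dot x x < 1].
    by apply/seteqP; split => [x /= /andP[]//|x [/= -> ->]].
  apply: openI; last exact: uball_open.
  apply: (@open_comp _ _ (fun x : V => dot x x) [set z | 0 < z]) => [x _|].
    exact: dotxx_continuous.
  exact: open_gt.
exists D; split.
- apply: (@limit_supersol R N _ u (fun x t => derive1 (u x) t) (ext0 phi) 0 0 D) =>
  //.
  + by move=> x t /andP[_ x1] t0; exact: u_cvg.
  + by move=> x t /andP[_ x1] t0; exact: is_derive_time.
  + move=> x t x01 t0; exists (laplacian (u^~ t) x).
      by apply: has_lap_slice => //; case/andP: x01.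
    by rewrite !mul0r !add0r; apply: le_trans (ler_norm _) (HD t x x01 t0).
  + by move=> x _; exact: (ext0_continuous homega).
  + move=> d d0; have [T T0 HT] := u_unif hu hut homega d0.
    by exists T => t Tt x /andP[_ x1]; rewrite ext0_in//; exact: HT.
- apply: (@limit_supersol R N _ (fun x t => - u x t) (fun x t => - derive1 (u x) t)
     (fun x => - ext0 phi x) 0 0 D) => //.
  + by move=> x t /andP[_ x1] t0; exact: (cvgN (u_cvg hu x1 t0)).
  + by move=> x t /andP[_ x1] t0; exact: (is_derive_funN (is_derive_time hu x1 t0)).
  + move=> x t x01 t0; exists (- laplacian (u^~ t) x).
      by apply: has_lapN; apply: has_lap_slice => //; case/andP: x01.
    rewrite !mul0r !add0r; apply: le_trans (HD t x x01 t0).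
    by rewrite -normrN ler_norm.
  + move=> x _; have h : ext0 phi y @[y --> x] --> ext0 phi x.
      exact: (ext0_continuous homega).
    exact: (cvgN h).
  + move=> d d0; have [T T0 HT] := u_unif hu hut homega d0.
    exists T => t Tt x /andP[_ x1]; rewrite ext0_in// -opprD normrN.
    exact: HT.
Qed.

Let i0 : 'I_N := Ordinal (ltnW hN).
Let e0 : V := delta_mx 0 i0.

Lemma e0_unit : dot e0 e0 = 1.
Proof. by rewrite dot_delta !mxE !eqxx. Qed.

(** The gradient bound passes to the limit along a radius. *)
Lemma axis_lipschitz (r1 r2 : R) : 0 <= r1 -> r1 <= r2 -> r2 < 1 ->
  `|ext0 phi (r2 *: e0) - ext0 phi (r1 *: e0)| <= G * (r2 - r1).
Proof.
move=> r10 r12 r21.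
have ins (r : R) : 0 <= r -> r < 1 -> dot (r *: e0) (r *: e0) < 1.
  by move=> ra rb; rewrite !dotE e0_unit mulr1 -expr2 expr_lt1.
have slice t : 0 < t -> `|u (r2 *: e0) t - u (r1 *: e0) t| <= G * (r2 - r1).
  move=> t0.
  have D (r : R) : 0 <= r -> r < 1 ->
      is_derive r 1 (fun r => u (r *: e0) t) (slice_d1 u t i0 (r *: e0)).
    move=> ra rb; have [+ _ _ _] := C2on_slice hu t0 (ins r ra rb).
    move=> /(_ i0); rewrite -[X in is_derive X]addr0 => /is_derive_lineP.
    by under eq_fun do rewrite addr0.
  have D1 (r : R) : r \in `]r1, r2[%R ->
      is_derive r 1 (fun r => u (r *: e0) t) (slice_d1 u t i0 (r *: e0)).
    rewrite in_itv/= => /andP[a1 a2]; apply: D; [exact/ltW/(le_lt_trans r10)|].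
    exact: lt_trans r21.
  have Cn : {within `[r1, r2], continuous (fun r : R => u (r *: e0) t)}.
    apply: derivable_within_continuous => r; rewrite in_itv/= => /andP[a1 a2].
    by have [] := D r (le_trans r10 a1) (le_lt_trans a2 r21).
  have [c] := MVT_segment r12 D1 Cn.
  rewrite in_itv/= => /andP[c1 c2] ->.
  rewrite normrM (ger0_norm (x := r2 - r1)) ?subr_ge0// ler_wpM2r ?subr_ge0//.
  have c1' := ins c (le_trans r10 c1) (le_lt_trans c2 r21).
  apply: le_trans (hgrad c1' t0).
  have := coord_sqr_le_dot (grad (u^~ t) (c *: e0)) i0.
  by rewrite -enorm_sqr mxE -(real_normK (num_real _)) ler_pXn2r// nnegrE ?enorm_ge0.
apply/ler_addgt0Pr => d d0.
have d2 : 0 < d / 2 by rewrite divr_gt0.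
have [T T0 HT] := u_unif hu hut homega d2.
have h1 := HT T (lexx _) _ (ins r1 r10 (le_lt_trans r12 r21)).
have h2 := HT T (lexx _) _ (ins r2 (le_trans r10 r12) r21).
have h3 := slice T T0.
rewrite !ext0_in; [|exact: ins (le_lt_trans r12 r21)|exact: ins (le_trans r10 r12)
  r21].
by move: h1 h2 h3; rewrite !ler_norml; lra.
Qed.

Lemma profile2_lipschitz (a : R) : 0 < a -> exists La : R, forall p q : R,
  a <= p -> a <= q -> p < 1 -> q < 1 ->
  `|profile2 e0 (ext0 phi) p - profile2 e0 (ext0 phi) q| <= La * `|p - q|.
Proof.
move=> a0; have sa : 0 < Num.sqrt a by rewrite sqrtr_gt0.
have G0 : 0 <= G by apply: le_trans (@hgrad 0 1 _ _); rewrite ?enorm_ge0// dot0l.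
exists (G / Num.sqrt a).
have main p q : a <= p -> p <= q -> q < 1 ->
    `|profile2 e0 (ext0 phi) p - profile2 e0 (ext0 phi) q| <= G / Num.sqrt a * `|p
      - q|.
  move=> ap pq q1.
  have q0 : 0 <= q by lra.
  have p0 : 0 <= p by lra.
  have spq : Num.sqrt p <= Num.sqrt q by rewrite ler_wsqrtr.
  have sap : Num.sqrt a <= Num.sqrt p by rewrite ler_wsqrtr.
  have sq1 : Num.sqrt q < 1 by rewrite -[ltRHS]sqrtr1 ltr_sqrt.
  rewrite distrC; apply: le_trans (axis_lipschitz (sqrtr_ge0 _) spq sq1) _.
  rewrite distrC ger0_norm ?subr_ge0// -mulrA ler_wpM2l// mulrC ler_pdivlMr//.
  rewrite -{2}(sqr_sqrtr q0) -{2}(sqr_sqrtr p0) subr_sqr ler_wpM2l ?subr_ge0//.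
  by have := sqrtr_ge0 q; lra.
move=> p q ap aq p1 q1; have [pq|/ltW qp] := leP p q; first exact: main.
by rewrite distrC (distrC p); exact: main.
Qed.

End Equation.

(** * Strict monotonicity of the profile *)

Section AxisDerivative.
Variables (R : realType) (N : nat).
Notation V := 'rV[R]_N.
Variables (phi : V -> R) (C : R).
Hypotheses (hN : (2 <= N)%N) (C0 : 0 <= C) (cphi : continuous phi)
  (phi_out : forall x, 1 <= dot x x -> phi x = 0)
  (phi_in : forall x, dot x x < 1 -> 0 < phi x)
  (sW : forall c, supersol (cap c) C 0 (Wdiff phi c)).
Variable e : V.
Hypothesis e1 : dot e e = 1.

Let b : R := (N%:R - 2) / 2.

(** On the axis the inversion fixes r and reverses the orientation: it sends r + t
    to g t with derivative -1 at t = 0. The weighted profile h turns the Kelvin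
    transform into a mere composition, so h (g t) - h (r + t) has derivative
    -2 h'(r) at 0, and it is at least k t by the Hopf estimate. *)
Lemma axis_derivative_lt0 (h : R -> R) (r : R) : 0 < r < 1 ->
  (forall s, 0 <= s -> h s = (1 + s ^+ 2) `^ b * phi (s *: e)) ->
  derivable h r 1 -> derive1 h r < 0.
Proof.
move=> r01 hE dh; have /andP[r0 r1] := r01.
have [k [rho [k0 rho0 rr Hk]]] := hopf_axis C0 cphi phi_out phi_in sW e1 r01.
set s := (1 - r ^+ 2) / (2 * r) in Hk.
have r2 : r ^+ 2 < 1 by rewrite expr_lt1// ltW.
have s0 : 0 < s by rewrite divr_gt0 ?mulr_gt0// subr_gt0.
pose K := 1 + s ^+ 2.
have rs : (r + s) ^+ 2 = K by rewrite /K /s; field; rewrite gt_eqF.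
pose g t := K / (r + t + s) - s.
have rs0 : 0 < r + s by exact: addr_gt0.
have g0 : g 0 = r by rewrite /g addr0 -rs; field; rewrite gt_eqF.
have dg : is_derive (0 : R) 1 g (-1).
  have q0 : (fun t : R => r + t + s) 0 != 0 by rewrite /= addr0 gt_eqF.
  have d1 := is_derive_funD (is_derive_funD (is_derive_funC r (0 : R) 1)
    (is_derive_fun_id (0 : R))) (is_derive_funC s (0 : R) 1).
  have dv : is_derive (0 : R) 1 (fun t => (r + t + s)^-1) (- (r + s) ^- 2).
    have := @is_deriveV R (fun t => r + t + s) 0 _ 1 q0 d1.
    by rewrite /= !addr0 add0r; congr (is_derive _ _ _ _); exact: mulr1.
  have := is_derive_funD (is_derive_funZ K dv) (is_derive_funC (- s) (0 : R) 1).
  by congr (is_derive _ _ _ _); rewrite -rs; field; rewrite gt_eqF.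
have dhr := derivableP dh; rewrite derive1E; set d := 'D_1 h r in dhr *.
have d1 : is_derive (0 : R) 1 (fun t => h (g t)) (d * -1).
  by apply: (is_derive1_comp (f := h)); rewrite ?g0.
have d2 : is_derive (0 : R) 1 (fun t => h (r + t)) (d * 1).
  apply: (is_derive1_comp (f := h) (g := fun t => r + t)); first by rewrite addr0.
  by have := is_derive_funD (is_derive_funC r (0 : R) 1) (is_derive_fun_id (0 :
    R)); rewrite add0r.
have dF := is_derive_funD d1 (is_derive_funN d2).
suff : k <= d * -1 - d * 1 by lra.
have rho1 : 0 < Num.min rho r by rewrite lt_min rho0.
apply: (slope_ge dF _ rho1); first by rewrite g0 addr0 subrr.
move=> t; rewrite le_min => /and3P[t0 trho tr].
have := Hk t; rewrite t0 trho => /(_ isT) kt.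
pose x := (r + t) *: e; pose c := s *: e.
have q0 : 0 < r + t + s by rewrite addr_gt0// ltr_wpDr.
have Sx : sqd c x = (r + t + s) ^+ 2.
  by rewrite sqdE /x /c !dotE e1; ring.
have S0 : 0 < sqd c x by rewrite Sx exprn_gt0.
have kE : kap c = K by rewrite /kap /c !dotE e1 /K; ring.
have m0 := mu_gt0 S0.
have iE : invc c x = g t *: e.
  rewrite /invc /mu Sx kE /x /c -scalerDl scalerA -scalerBl /g; congr (_ *: _).
  by field; rewrite gt_eqF.
have gt0 : 0 <= g t.
  rewrite /g subr_ge0 ler_pdivlMr//.
  have a1 : s * (r + t) <= s * (2 * r) by rewrite ler_wpM2l ?(ltW s0)//; lra.
  have a2 : s * (2 * r) = 1 - r ^+ 2 by rewrite /s divfK// gt_eqF// mulr_gt0.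
  have := sqr_ge0 r.
  by rewrite /K; lra.
have E := invc_dot S0; rewrite iE !dotE e1 !mulr1 -!expr2 in E.
rewrite !hE//; last by rewrite addr_ge0// ltW.
have xx : dot x x = (r + t) ^+ 2 by rewrite /x !dotE e1; ring.
have p0 : 0 <= 1 + (r + t) ^+ 2 by rewrite addr_ge0// sqr_ge0.
rewrite E powRM ?(ltW m0)//.
have -> : mu c x `^ b * (1 + (r + t) ^+ 2) `^ b * phi (g t *: e) -
    (1 + (r + t) ^+ 2) `^ b * phi ((r + t) *: e) =
   (1 + (r + t) ^+ 2) `^ b * Wdiff phi c x.
  by rewrite /Wdiff /kelvin iE -/b /x; ring.
have W0 : 0 <= Wdiff phi c x by apply: le_trans (kt); rewrite mulr_ge0// ltW.
apply: le_trans kt _.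
rewrite ler_peMl// -[leLHS](congr1 (@^~ b) (@powR1 R)).
apply: ge0_ler_powR; rewrite ?nnegrE ?(b_ge0 R hN)//.
by rewrite lerDl sqr_ge0.
Qed.

End AxisDerivative.

Theorem theorem1p1 (R : realType) (N : nat) (alpha : R)
  (f : R -> R -> R -> R) (u : 'rV[R]_N -> R -> R)
  (hN : (2 <= N)%N) (halpha : 0 < alpha < 1)
  (hF1 : F1 f) (hF2 : F2 alpha f) (hF3 : F3 N f)
  (hC21 : C21 u)
  (hC : {within ccylinder R N, continuous (fun p => u p.1 p.2)})
  (hbounded : exists M : R, forall (x : 'rV[R]_N) (t : R),
     unit_ball R N x -> 0 < t -> `|u x t| <= M)
  (hpos : forall (x : 'rV[R]_N) (t : R), unit_ball R N x -> 0 < t -> 0 < u x t)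
  (hpde : forall (x : 'rV[R]_N) (t : R), unit_ball R N x -> 0 < t ->
     derive1 (u x) t - laplacian (u^~ t) x = f (enorm x) (u x t) t)
  (hbdry : forall (x : 'rV[R]_N) (t : R),
     unit_sphere R N x -> 0 < t -> u x t = 0)
  (hut_ge0 : forall (x : 'rV[R]_N) (t : R),
     unit_ball R N x -> 0 < t -> 0 <= derive1 (u x) t)
  (hut_bounded : exists M : R, forall (x : 'rV[R]_N) (t : R),
     unit_ball R N x -> 0 < t -> `|derive1 (u x) t| <= M)
  (hgrad_bounded : exists M : R, forall (x : 'rV[R]_N) (t : R),
     unit_ball R N x -> 0 < t -> enorm (grad (u^~ t) x) <= M) :
  forall phi, omega_limit u phi ->
    (forall x : 'rV[R]_N, unit_cball R N x -> phi x = 0) \/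
    (exists g : R -> R, radial_profile phi g /\
       forall r : R, 0 < r < 1 ->
         let h (s : R) : R := (1 + s ^+ 2) `^ ((N%:R - 2) / 2) * g s in
         derivable h r 1 /\ derive1 h r < 0).
Proof.
move=> phi homega; right.
have toB x : dot x x < 1 -> unit_ball R N x by move/unit_ballE.
have [M1 hM1] := hbounded; have [Mt hMt] := hut_bounded.
have [G hG] := hgrad_bounded.
have hpos' x t : dot x x < 1 -> 0 < t -> 0 < u x t by move=> /toB; exact: hpos.
have hut' x t : dot x x < 1 -> 0 < t -> 0 <= derive1 (u x) t.
  by move=> /toB; exact: hut_ge0.
have hpde' x (t : R) : dot x x < 1 -> 0 < t ->
    derive1 (u x) t - laplacian (u^~ t) x = f (enorm x) (u x t) t.
  by move=> /toB; exact: hpde.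
have hMt' x t : dot x x < 1 -> 0 < t -> `|derive1 (u x) t| <= Mt.
  by move=> /toB; exact: hMt.
have hG' x t : dot x x < 1 -> 0 < t -> enorm (grad (u^~ t) x) <= G.
  by move=> /toB; exact: hG.
pose M := `|M1| + 1.
have M0 : 0 < M by rewrite ltr_wpDl.
have hM x t : dot x x < 1 -> 0 < t -> `|u x t| <= M.
  move=> /toB x1 t0; apply: le_trans (hM1 x t x1 t0) _.
  by rewrite /M; have := ler_norm M1; lra.
have [L L0 HL] := lip_f hF1 M0.
pose p := ext0 phi.
have cp : continuous p := ext0_continuous homega.
have p_out x : 1 <= dot x x -> p x = 0 := @ext0_out R N phi x.
have p_in x : dot x x < 1 -> 0 < p x by exact: (ext0_gt0 hC21 hpos' hut' homega).
have sW := Wdiff_supersol hN hF1 hF3 hC21 M0 hM hpos' hpde' hut' homega L0 HL.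
have [D [sp sNp]] := phi_supersol hN halpha hF1 hF2 hC21 M0 hM hpos' hpde' hut'
  hMt' homega.
pose e : 'rV[R]_N := delta_mx 0 (Ordinal (ltnW hN)).
have e1 : dot e e = 1 by exact: e0_unit.
have rad x y : dot x x < 1 -> dot x x = dot y y -> p x = p y.
  apply: radial_of_reflections => e' z e1' x1 ex.
  exact: (reflection_le L0 cp p_out p_in sW e1' x1 ex).
have radp x : dot x x < 1 -> p x = profile2 e p (dot x x).
  by move=> x1; apply: rad => //; rewrite dot_profile// dot_ge0.
pose g r := p (r *: e).
exists g; split.
  move=> x x1; rewrite (ext0_cball homega x1) /g.
  have ee : dot (enorm x *: e) (enorm x *: e) = dot x x.
    by rewrite !dotE e1 mulr1 -expr2 enorm_sqr.
  have [x1'|x1'] := ltP (dot x x) 1; first by apply: rad; rewrite ?ee.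
  by rewrite -/p !p_out ?ee.
move=> r r01 h; have /andP[r0 r1] := r01.
have dh : derivable h r 1.
  have r2 : 0 < r ^+ 2 < 1 by rewrite exprn_gt0//= expr_lt1// ltW.
  have lip := profile2_lipschitz hN hC21 hut' hG' homega.
  have dk := profile2_derivable e1 cp radp sp sNp lip r2.
  have d2 := is_derive_funM (is_derive_fun_id r) (is_derive_fun_id r).
  have dg : is_derive r 1 (fun s => profile2 e p (s * s)) ('D_1 (profile2 e p) (r
    ^+ 2) * (r * 1 + r * 1)).
    apply: (is_derive1_comp (f := profile2 e p) (g := fun s => s * s)).
    by rewrite -expr2; exact: derivableP.
  have n0 : \forall s \near r, 0 < s by exact: (cvgr_gt _ (@cvg_id _ (nbhs r)) _ r0).
  have dg' : is_derive r 1 g ('D_1 (profile2 e p) (r ^+ 2) * (r * 1 + r * 1)).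
    apply: near_eq_is_derive dg; apply: filterS n0 => s s0.
    by rewrite /profile2 -expr2 sqrtr_sqr gtr0_norm.
  have w0 : 0 < (fun s : R => 1 + s * s) r by rewrite ltr_pwDl// -expr2 sqr_ge0.
  have dw := is_derive_funD (is_derive_funC 1 r 1) d2.
  have dpw := @is_derive1_comp R (fun a => a `^ ((N%:R - 2) / 2)) (fun s => 1 + s * s)
    r _ _ (is_derive1_powR ((N%:R - 2) / 2) w0) dw.
  have [+ _] := is_derive_funM dpw dg'.
  by [].
split=> //.
by apply: (axis_derivative_lt0 hN L0 cp p_out p_in sW e1 r01 (h := h)).
Qed.
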